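(* Let $X$ be a real Banach space satisfying one of the following: (a) $X=W^*$ for some $L^1$-predual space $W$; (b) $X=N(K,\mathbb{R})$ for some hyperstonean space $K$; (c) $X$ is an abstract $L_1$-space. Let $Y$ be an arbitrary real Banach space and $Z$ a closed subspace of $Y$. Let $T\in\mathcal{K}(X,Y)$ be a multi-smooth operator of finite order with $T\perp_B\mathcal{L}(X,Z)$. Then the following hold. (i) $d(T,\mathcal{L}(X,Z))=\sup_{x\in S_X}d(Tx,Z)$. (ii) $T^{**}x_0^{**}\perp_B Z^{\perp\perp}$ for some $x_0^{**}\in M_{T^{**}}\cap E_{X^{**}}$. (iii) $T^{**}\perp_B\mathcal{L}(X^{**},Z^{\perp\perp})$. (iv) There exists $x_0^{**}\in M_{T^{**}}\cap E_{X^{**}}$ such that $$d(T^{**},\mathcal{L}(X^{**},Z^{\perp\perp}))=\sup_{x^{**}\in S_{X^{**}}}d(T^{**}x^{**},Z^{\perp\perp})=d(T^{**}x_0^{**},Z^{\perp\perp})=d(T,\mathcal{L}(X,Z)).$$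
   Context: All Banach spaces are real. $\mathcal{L}(X,Y)$ (respectively $\mathcal{K}(X,Y)$) is the space of bounded (respectively compact) linear operators with the operator norm; for a subspace $Z\subset Y$, $\mathcal{L}(X,Z)$ is regarded as a subspace of $\mathcal{L}(X,Y)$. $S_X$, $B_X$ are the unit sphere and closed unit ball of $X$; $E_X$ is the set of extreme points of $B_X$. For an operator $T$ on $X$, $M_T=\{x\in S_X:\|Tx\|=\|T\|\}$. For a subspace $W$ of a normed space $V$ and $v\in V$, $d(v,W)=\inf_{w\in W}\|v-w\|$. Birkhoff-James orthogonality: $v\perp_B w$ means $\|v+\lambda w\|\ge\|v\|$ for all scalars $\lambda$; $v\perp_B W$ means $v\perp_B w$ for all $w\in W$. $Z^\perp=\{y^*\in Y^*:y^*(z)=0\ \forall z\in Z\}$ and $Z^{\perp\perp}\subset Y^{**}$ is the annihilator of $Z^\perp$; $T^{**}:X^{**}\to Y^{**}$ is the second adjoint, and $\mathcal{L}(X^{**},Z^{\perp\perp})$ is regarded as a subspace of $\mathcal{L}(X^{**},Y^{**})$. A non-zero $T\in\mathcal{L}(X,Y)$ is a multi-smooth operator of finite order if the linear span of $J(T)=\{f\in S_{\mathcal{L}(X,Y)^*}:f(T)=\|T\|\}$ is finite-dimensional. A Banach space $V$ is an $L^1$-predual space if $V^*$ is isometrically isomorphic to $L^1(\mu)$ for some positive measure $\mu$. An abstract $L_1$-space is a Banach lattice in which $\|x+y\|=\|x\|+\|y\|$ for all $x,y\ge 0$. For a compact Hausdorff space $K$, a positive regular Borel measure $\mu$ on $K$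 is normal if $\int f_\alpha\,d\mu\to 0$ for every decreasing net $(f_\alpha)$ in $C(K)$ whose infimum in the lattice $C(K)$ is $0$; $N(K,\mathbb{R})^+$ is the set of positive (finite) normal regular Borel measures and $N(K,\mathbb{R})=N(K,\mathbb{R})^+-N(K,\mathbb{R})^+$, with the total variation norm. $K$ is hyperstonean if it is compact Hausdorff, extremally disconnected, and the union of the supports of the measures in $N(K,\mathbb{R})^+$ is dense in $K$. *)

(* Defs.v *)
From HB Require Import structures.
From mathcomp Require Import all_boot all_order all_algebra.
From mathcomp Require Import all_classical all_reals all_analysis.

Set Implicit Arguments.
Unset Strict Implicit.
Unset Printing Implicit Defensive.
Import Order.TTheory GRing.Theory Num.Theory.
Import numFieldNormedType.Exports.

Local Open Scope classical_set_scope.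
Local Open Scope ring_scope.

Definition unit_ball {R : realType} (V : normedModType R) : set V :=
  [set x | `|x| <= 1].

Definition unit_sphere {R : realType} (V : normedModType R) : set V :=
  [set x | `|x| = 1].

Arguments unit_ball {R} V _.
Arguments unit_sphere {R} V _.

Section BoundedOperators.
Context {R : realType} (X Y : normedModType R).

Definition bounded_linear : {pred X -> Y} := fun f =>
  `[< linear f /\ exists M : R, forall x, `|f x| <= M * `|x| >].

Lemma bounded_linearP (f : X -> Y) :
  reflect (linear f /\ exists M : R, forall x, `|f x| <= M * `|x|)
          (f \in bounded_linear).
Proof. exact: asboolP. Qed.

Lemma bounded_linear_submod_closed : submod_closed bounded_linear.
Proof.
split.
  apply/bounded_linearP; split; first by move=> a x y /=; rewrite scaler0 addr0.
  by exists 0 => x; rewrite normr0 mul0r.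
move=> a f g /bounded_linearP[lf [M fM]] /bounded_linearP[lg [N gN]].
apply/bounded_linearP; split.
  move=> b x y; rewrite !fctE lf lg !scalerDr !scalerA [b * a]mulrC.
  by rewrite addrACA.
exists (`|a| * M + N) => x; rewrite !fctE mulrDl.
rewrite (le_trans (ler_normD _ _))// lerD// normrZ -mulrA.
by rewrite ler_wpM2l.
Qed.

HB.instance Definition _ := GRing.isSubmodClosed.Build R (X -> Y)
  bounded_linear bounded_linear_submod_closed.

Record BL := MkBL { blfun :> X -> Y ; blfunP : blfun \in bounded_linear }.

HB.instance Definition _ := [isSub for blfun].
HB.instance Definition _ := [Choice of BL by <:].
HB.instance Definition _ := [SubChoice_isSubLmodule of BL by <:].

Lemma bl_linear (f : BL) : linear f.
Proof. by case/bounded_linearP: (blfunP f). Qed.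

HB.instance Definition _ (f : BL) :=
  GRing.isLinear.Build R X Y *:%R (f : X -> Y) (bl_linear f).

Definition opnorm (f : BL) : R := sup [set `|f x| | x in unit_ball X].

Lemma blD (f g : BL) x : (f + g) x = f x + g x. Proof. by []. Qed.
Lemma blZ a (f : BL) x : (a *: f) x = a *: f x. Proof. by []. Qed.

Lemma opnorm_has_sup (f : BL) : has_sup [set `|f x| | x in unit_ball X].
Proof.
split; first by exists `|f 0|; exists 0 => //; rewrite /unit_ball/= normr0.
have /bounded_linearP[_ [M fM]] := blfunP f.
exists `|M| => _ [x /= x1 <-]; rewrite (le_trans (fM x))//.
rewrite (le_trans (ler_norm _))// normrM normr_id ler_piMr//.
Qed.

Lemma opnorm_ubound (f : BL) x : `|f x| <= opnorm f * `|x|.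
Proof.
have [->|x0] := eqVneq x 0; first by rewrite linear0 !normr0 mulr0.
rewrite -ler_pdivrMr ?normr_gt0// mulrC.
have -> : `|x|^-1 * `|f x| = `|f (`|x|^-1 *: x)|.
  by rewrite linearZ normrZ ger0_norm// invr_ge0.
apply: sup_upper_bound; first exact: opnorm_has_sup.
exists (`|x|^-1 *: x) => //=.
by rewrite /unit_ball/= normrZ ger0_norm ?invr_ge0// mulVf// normr_eq0.
Qed.

Lemma opnorm_le (f : BL) M : (forall x, `|x| <= 1 -> `|f x| <= M) ->
  opnorm f <= M.
Proof.
move=> fM; apply: ge_sup; first by case: (opnorm_has_sup f).
by move=> _ [x /= x1 <-]; exact: fM.
Qed.

Lemma opnorm_ge0 (f : BL) : 0 <= opnorm f.
Proof.
apply: (@le_trans _ _ `|f 0|) => //.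
apply: sup_upper_bound; first exact: opnorm_has_sup.
by exists 0 => //; rewrite /unit_ball/= normr0.
Qed.

Lemma opnorm_triangle (f g : BL) : opnorm (f + g) <= opnorm f + opnorm g.
Proof.
apply: opnorm_le => x x1; rewrite blD (le_trans (ler_normD _ _))// lerD//.
- by rewrite (le_trans (opnorm_ubound f x))// ler_piMr// opnorm_ge0.
- by rewrite (le_trans (opnorm_ubound g x))// ler_piMr// opnorm_ge0.
Qed.

Let opnormZ_le (a : R) (f : BL) : opnorm (a *: f) <= `|a| * opnorm f.
Proof.
apply: opnorm_le => x x1; rewrite blZ normrZ ler_wpM2l//.
by rewrite (le_trans (opnorm_ubound f x))// ler_piMr// opnorm_ge0.
Qed.

Lemma opnormZ (a : R) (f : BL) : opnorm (a *: f) = `|a| * opnorm f.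
Proof.
apply/eqP; rewrite eq_le opnormZ_le/=.
have [->|a0] := eqVneq a 0; first by rewrite normr0 mul0r opnorm_ge0.
rewrite -ler_pdivlMl ?normr_gt0// -normfV.
by rewrite -[in leLHS](scalerK a0 f) opnormZ_le.
Qed.

Lemma opnorm0_eq0 (f : BL) : opnorm f = 0 -> f = 0.
Proof.
move=> f0; apply/val_inj/funext => x /=; apply/eqP.
by rewrite -normr_le0 (le_trans (opnorm_ubound f x))// f0 mul0r.
Qed.

HB.instance Definition _ := Lmodule_isNormed.Build R BL
  opnorm_triangle opnormZ opnorm0_eq0.

Lemma bl_normE (f : BL) : `|f| = sup [set `|f x| | x in unit_ball X].
Proof. by []. Qed.

Lemma bl_norm_le (f : BL) x : `|f x| <= `|f| * `|x|.
Proof. exact: opnorm_ubound. Qed.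

End BoundedOperators.

Arguments bounded_linear {R} X Y _.

Definition dual {R : realType} (X : normedModType R) : normedModType R :=
  BL X R^o.

Section Adjoint.
Context {R : realType} (X Y : normedModType R).

Lemma bl_comp_subproof (T : BL X Y) (f : BL Y R^o) :
  (f \o T) \in bounded_linear X R^o.
Proof.
apply/bounded_linearP; split; first by move=> a x y /=; rewrite !linearP.
exists (`|f| * `|T|) => x /=.
by rewrite (le_trans (bl_norm_le f _))// -mulrA ler_wpM2l// bl_norm_le.
Qed.

Definition adjoint_fun (T : BL X Y) (f : dual Y) : dual X :=
  MkBL (bl_comp_subproof T f).

Lemma adjoint_subproof (T : BL X Y) :
  adjoint_fun T \in bounded_linear (dual Y) (dual X).
Proof.
apply/bounded_linearP; split.
  by move=> a f g; apply/val_inj/funext.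
exists `|T| => f; apply: opnorm_le => x x1.
rewrite /= (le_trans (bl_norm_le f _))// mulrC ler_wpM2r//.
by rewrite (le_trans (bl_norm_le T _))// ler_piMr.
Qed.

Definition adjoint (T : BL X Y) : BL (dual Y) (dual X) :=
  MkBL (adjoint_subproof T).

Definition annihilator (Z : set Y) : set (dual Y) :=
  [set f : dual Y | forall z, Z z -> f z = 0].

Definition ops_into (Z : set Y) : set (BL X Y) := [set S | forall x, Z (S x)].

Definition norm_attaining (T : BL X Y) : set X :=
  unit_sphere X `&` [set x | `|T x| = `|T|].

Definition compact_op (T : BL X Y) := precompact (T @` unit_ball X).

End Adjoint.

Arguments ops_into {R} X {Y} Z _.

Definition biadjoint {R : realType} (X Y : normedModType R) (T : BL X Y) :
  BL (dual (dual X)) (dual (dual Y)) := adjoint (adjoint T).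

Section Geometry.
Context {R : realType} (V : normedModType R).

Definition dist_to (v : V) (W : set V) : R := inf [set `|v - w| | w in W].

Definition bj_orth (v w : V) := forall a : R, `|v| <= `|v + a *: w|.

Definition bj_orth_set (v : V) (W : set V) := forall w, W w -> bj_orth v w.

Definition extreme_points (A : set V) : set V :=
  [set x | A x /\ forall (y z : V) (t : R), A y -> A z -> 0 < t < 1 ->
                    x = t *: y + (1 - t) *: z -> y = x /\ z = x].

Definition linear_subspace (A : set V) :=
  A 0 /\ forall (a : R) x y, A x -> A y -> A (a *: x + y).

Definition linear_span (A : set V) : set V :=
  [set v | exists n (c : 'I_n -> R) (x : 'I_n -> V),
     (forall i, A (x i)) /\ v = \sum_(i < n) c i *: x i].

Definition finite_dimensional (A : set V) :=
  exists n (e : 'I_n -> V), A = linear_span (range e).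

Definition support_functionals (v : V) : set (dual V) :=
  unit_sphere (dual V) `&` [set f : dual V | f v = `|v|].

End Geometry.

Definition multi_smooth_finite_order {R : realType} (X Y : normedModType R)
    (T : BL X Y) :=
  T <> 0 /\ finite_dimensional (linear_span (support_functionals T)).

Definition isometrically_isomorphic {R : realType} (V U : normedModType R) :=
  exists phi : {linear V -> U},
    (forall x, `|phi x| = `|x|) /\ (forall u, exists x, phi x = u).

(* [LfunType mu 1] consists of functions, not of classes of functions modulo
   equality almost everywhere, and ['N[mu]_1[_]] is only a seminorm on it. The
   map [phi] below is an isometric isomorphism from L^1(mu) onto the dual of V,
   precomposed with the quotient map. *)
Definition L1_predual {R : realType} (V : completeNormedModType R) :=
  exists (d : measure_display) (T : measurableType d)
      (mu : {measure set T -> \bar R})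
      (phi : {linear LfunType mu (@lexx _ _ 1%E) -> dual V}),
    (forall f, (`|phi f|)%:E = 'N[mu]_1[EFin \o f]%E) /\
    (forall u, exists f, phi f = u).

(* The meet of x and y is - join (- x) (- y), and the modulus of x is
   join x (- x). *)
Record banach_lattice {R : realType} (V : completeNormedModType R)
    (le : V -> V -> Prop) (join : V -> V -> V) : Prop := BanachLattice {
  lattice_refl : forall x, le x x ;
  lattice_antisym : forall x y, le x y -> le y x -> x = y ;
  lattice_trans : forall x y z, le x y -> le y z -> le x z ;
  lattice_add : forall x y z, le x y -> le (x + z) (y + z) ;
  lattice_scale : forall (a : R) x y, 0 <= a -> le x y -> le (a *: x) (a *: y) ;
  lattice_joinl : forall x y, le x (join x y) ;
  lattice_joinr : forall x y, le y (join x y) ;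
  lattice_join_least : forall x y z, le x z -> le y z -> le (join x y) z ;
  lattice_norm : forall x y,
    le (join x (- x)) (join y (- y)) -> `|x| <= `|y| }.

Definition abstract_L1_space {R : realType} (V : completeNormedModType R) :=
  exists (le : V -> V -> Prop) (join : V -> V -> V),
    banach_lattice le join /\
    forall x y, le 0 x -> le 0 y -> `|x + y| = `|x| + `|y|.

Definition borel (K : ptopologicalType) := g_sigma_algebraType (@open K).

Section NormalMeasures.
Context {R : realType} (K : ptopologicalType).
Implicit Types mu : {finite_measure set (borel K) -> \bar R}.

Definition regular_measure mu := forall A : set (borel K), measurable A ->
  mu A = ereal_inf [set mu U | U in [set U : set K | open U /\ A `<=` U]] /\
  mu A = ereal_sup [set mu C | C in [set C : set K | compact C /\ C `<=` A]].

Definition directed {I : Type} (le : I -> I -> Prop) :=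
  [/\ inhabited I,
      forall i, le i i,
      forall i j k, le i j -> le j k -> le i k &
      forall i j, exists k, le i k /\ le j k].

(* The infimum is taken in the lattice C(K), hence need not be pointwise. *)
Definition decreasing_to_0 {I : Type} (le : I -> I -> Prop)
    (f : I -> K -> R) :=
  [/\ forall i, continuous (f i),
      forall i j, le i j -> forall x, f j x <= f i x,
      forall i x, 0 <= f i x &
      forall g : K -> R, continuous g ->
        (forall i x, g x <= f i x) -> forall x, g x <= 0].

Definition normal_measure mu :=
  regular_measure mu /\
  forall (I : Type) (le : I -> I -> Prop) (f : I -> K -> R),
    directed le -> decreasing_to_0 le f ->
    forall e : R, 0 < e -> exists i0, forall i, le i0 i ->
      `| \int[mu]_x (f i x : R) | < e.

Definition measure_support mu : set K :=
  [set x | forall U : set K, open U -> U x -> (0 < mu U)%E].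

Definition normal_charge (nu : {charge set (borel K) -> \bar R}) :=
  exists mu1 mu2 : {finite_measure set (borel K) -> \bar R},
    [/\ normal_measure mu1, normal_measure mu2 &
        forall A, measurable A -> nu A = (mu1 A - mu2 A)%E].

Definition charge_total_variation
    (nu : {charge set (borel K) -> \bar R}) : \bar R :=
  let P := cid (Hahn_decomposition nu) in
  let N := cid (projT2 P) in
  charge_variation (projT2 N) setT.

End NormalMeasures.

Definition extremally_disconnected (K : topologicalType) :=
  forall U : set K, open U -> open (closure U).

Definition hyperstonean (R : realType) (K : ptopologicalType) :=
  [/\ compact [set: K], hausdorff_space K, extremally_disconnected K &
      dense (\bigcup_(mu in [set mu : {finite_measure set (borel K) -> \bar R}
                               | normal_measure mu]) measure_support mu)].

(* V is isometrically isomorphic to N(K, R). Charges are functions on all sets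
   and only their values on Borel sets matter, so equality and linearity are
   required on Borel sets. *)
Definition isometric_to_normal_charges {R : realType} (V : normedModType R)
    (K : ptopologicalType) :=
  exists J : V -> {charge set (borel K) -> \bar R},
    [/\ forall x, normal_charge (J x),
        forall (a : R) x y A, measurable A ->
          J (a *: x + y) A = (a%:E * J x A + J y A)%E,
        forall nu, normal_charge nu ->
          exists x, forall A, measurable A -> J x A = nu A &
        forall x, (`|x|)%:E = charge_total_variation (J x)].

(* Main.v *)
Require Import Defs.
From HB Require Import structures.
From mathcomp Require Import all_boot all_order all_algebra.
From mathcomp Require Import all_classical all_reals all_analysis.
From mathcomp Require Import measurable_realfun ring lra.
Import Order.TTheory GRing.Theory Num.Theory.
Import numFieldNormedType.Exports.

Local Open Scope classical_set_scope.
Local Open Scope ring_scope.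

(** In an abstract L1-space an atom $e$, that is a unit vector of the positive
    cone such that every $u$ with $0 \le u \le e$ is a multiple of $e$, spans an
    L-summand: $\|x\| = |\varphi (x)| + \|x - \varphi (x) e\|$ for a functional
    $\varphi$ ([atom_L_projection]). The theorem holds because $T$ attains its
    norm at finitely many atoms $e_1, \dots, e_m$ and has smaller norm on their
    common complement ([complete_atom_system]).

    Given such atoms, some $T e_i$ is orthogonal to $Z$ ([bj_orth_attained]):
    otherwise there are $z_i \in Z$ with $\|T e_i + z_i\| < \|T\|$, and
    $T + \sum_i \varphi_i \otimes z_i$ has norm less than $\|T\|$, since the norm
    of an operator on an $\ell^1$-sum is the largest of the norms on the
    summands. Put $x_0^{**} = e_i$. It is an extreme point of the ball of
    $X^{**}$ because $e_i$ spans an L-summand ([L_projection_extreme]). A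
    norm-one functional that vanishes on $Z$ and attains the norm of $T e_i$
    shows that $T^{**} x_0^{**}$ is orthogonal to $Z^{\perp\perp}$, and all the
    distances and suprema in question equal $\|T\|$ ([L1_cone_conclusion]).

    To find a first atom, let $h$ be a functional $y^* \circ T$ of norm $\|T\|$,
    which exists because $T$ is compact; further atoms are found in the same
    way on the complement of the previous ones. Either $h$ attains its norm at
    an atom, up to a sign, or there are unit vectors $v_n$ with $|h (v_n)| \to \|h\|$
    whose overlaps are so small that they span a copy of $\ell^1$
    ([signed_atom_or_l1_sequence]). If $h$ attains its norm, the vectors where it
    does form a face of the cone; without atoms in it a vector of this face can
    be split for ever into disjoint pieces. If $h$ does not attain its norm,
    vectors that nearly attain it eventually avoid any given vector
    ([small_overlap]). A copy of $\ell^1$ contradicts the hypothesis on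
    $J (T)$: every bounded sequence of values at the $v_n$ is taken by some
    functional on $X$, so that generalized limits of
    $S \mapsto y^* (S v_n)$ along disjoint sets of indices are linearly
    independent elements of $J (T)$ ([multi_smooth_no_biorthogonal]). The atoms
    are finitely many for the same reason.

    The order structure of $X$ enters through the positive cone and the positive
    part ([L1_cone]). They are read off from the lattice if $X$ is an abstract
    L1-space. The dual of an L1-predual is a space of classes of integrable
    functions, where the positive part is taken pointwise; in $N(K)$ it is
    given by a Hahn decomposition. *)

Set Implicit Arguments.
Unset Strict Implicit.
Unset Printing Implicit Defensive.

(** * The theorem of Hahn and Banach *)

Definition sublinear {R : realType} {V : lmodType R} (p : V -> R) :=
  (forall x y, p (x + y) <= p x + p y) /\
  (forall a x, 0 <= a -> p (a *: x) <= a * p x).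

Lemma sublinear0 {R : realType} {V : lmodType R} (p : V -> R) :
  sublinear p -> p 0 = 0.
Proof.
move=> [pD pZ]; have := pZ 0 0 (lexx _); have := pD 0 0.
by rewrite scale0r mul0r addr0; lra.
Qed.

Lemma sublinearZ {R : realType} {V : lmodType R} (p : V -> R) a x :
  sublinear p -> 0 <= a -> p (a *: x) = a * p x.
Proof.
move=> sp; have [pD pZ] := sp; rewrite le_eqVlt => /predU1P[<-|a0].
  by rewrite scale0r mul0r sublinear0.
apply/eqP; rewrite eq_le; apply/andP; split; first by apply: pZ; exact: ltW.
have := pZ a^-1 (a *: x); rewrite scalerA mulVf ?gt_eqF// scale1r.
by rewrite ler_pdivlMl//; apply; rewrite invr_ge0 ltW.
Qed.

Lemma sublinear_inf {R : realType} {V : lmodType R} (S : V -> set R) :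
  (forall x, has_inf (S x)) ->
  (forall x y r s, S x r -> S y s -> exists2 u, S (x + y) u & u <= r + s) ->
  (forall a x r, 0 <= a -> S x r -> exists2 u, S (a *: x) u & u <= a * r) ->
  sublinear (fun x => inf (S x)).
Proof.
move=> Sinf SD SZ.
have infP x e : 0 < e -> exists2 r, S x r & r < inf (S x) + e.
  by move=> e0; exact: (inf_adherent e0 (Sinf x)).
have infL x r : S x r -> inf (S x) <= r by apply: ge_inf; exact: proj2 (Sinf x).
split=> [x y|a x a0].
  apply/ler_addgt0Pl => e e0; have e2 : 0 < e / 2 by rewrite divr_gt0.
  have [r Sr re] := infP x _ e2; have [s Ss se] := infP y _ e2.
  have [u Su us] := SD _ _ _ _ Sr Ss.
  have := infL _ _ Su; lra.
apply/ler_addgt0Pl => e e0.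
have e2 : 0 < e / (a + 1) by rewrite divr_gt0// ltr_wpDl.
have [r Sr re] := infP x _ e2; have [u Su us] := SZ a _ _ a0 Sr.
apply: (le_trans (infL _ _ Su)); apply: (le_trans us).
have ar : a * r <= a * (inf (S x) + e / (a + 1)) by rewrite ler_wpM2l// ltW.
apply: (le_trans ar); rewrite mulrDr addrC lerD2r mulrA ler_pdivrMr ?ltr_wpDl//.
by rewrite mulrDr mulr1 [e * a]mulrC lerDl ltW.
Qed.

(** A sublinear functional that is minimal in the pointwise order is linear:
    the functional $x \mapsto \inf_{t \ge 0} (q (x + t x_0) - t q (x_0))$ is
    sublinear and below $q$, so minimality forces
    $q (x) \le q (x + x_0) - q (x_0)$. Minimal functionals below $p$ exist by
    the lemma of Zorn. *)
Theorem hahn_banach {R : realType} {V : lmodType R} (p : V -> R) :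
  sublinear p -> exists f : {linear V -> R^o}, forall x, f x <= p x.
Proof.
move=> sp; have [pD pZ] := sp.
pose Q := {q : V -> R | sublinear q /\ forall x, q x <= p x}.
pose mkQ q qP : Q := exist (fun q => sublinear q /\ forall x, q x <= p x) q qP.
pose below (q r : Q) := `[< forall x, sval r x <= sval q x >].
have lowerb (q : V -> R) x : sublinear q -> - q (- x) <= q x.
  move=> sq; have := sublinear0 sq; rewrite -(subrr x) => q0.
  by have := sq.1 x (- x); rewrite q0; lra.
have [||||q qmin] := @Zorn Q below.
- by move=> q; apply/asboolP.
- move=> q r s /asboolP qr /asboolP rs; apply/asboolP => x.
  exact: le_trans (rs x) (qr x).
- move=> [q Pq] [r Pr] /asboolP/= qr /asboolP/= rq; apply: eq_exist.
  by apply/funext => x; apply/eqP; rewrite eq_le qr rq.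
- move=> A Atot; have [[q0 Aq0]|A0] := pselect (exists q, A q); last first.
    have sp' : sublinear p /\ forall x, p x <= p x by [].
    by exists (mkQ p sp') => q Aq; case: A0; exists q.
  pose S x := [set sval q x | q in A].
  have Sinf x : has_inf (S x).
    split; first by exists (sval q0 x), q0.
    exists (- p (- x)) => _ [q Aq <-]; have [sq qp] := svalP q.
    by apply: le_trans (lowerb _ x sq); rewrite lerN2.
  have sS : sublinear (fun x => inf (S x)).
    apply: sublinear_inf => // [x y _ _ [q Aq <-] [r Ar <-]|a x _ a0 [q Aq <-]].
      have [/asboolP qr|/asboolP rq] := Atot _ _ Aq Ar.
        exists (sval r (x + y)); first by exists r.
        by apply: le_trans ((svalP r).1.1 _ _) _; rewrite lerD2r.
      exists (sval q (x + y)); first by exists q.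
      by apply: le_trans ((svalP q).1.1 _ _) _; rewrite lerD2l.
    exists (sval q (a *: x)); first by exists q.
    exact: (svalP q).1.2.
  have Sp x : inf (S x) <= p x.
    apply: le_trans ((svalP q0).2 x); apply: (ge_inf (proj2 (Sinf x))).
    by exists q0.
  exists (mkQ _ (conj sS Sp)) => q Aq; apply/asboolP => x /=.
  by apply: (ge_inf (proj2 (Sinf x))); exists q.
have [sq qp] := svalP q; set f := sval q in sq qp.
have fD x0 x : f x + f x0 <= f (x + x0).
  pose S x := [set f (x + t *: x0) - t * f x0 | t in [set t : R | 0 <= t]].
  have Sinf y : has_inf (S y).
    split; first by exists (f (y + 0 *: x0) - 0 * f x0), 0 => /=.
    exists (- f (- y)) => _ [t /= t0 <-].
    have := sq.1 (y + t *: x0) (- y).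
    by rewrite addrAC subrr add0r sublinearZ//; lra.
  have sS : sublinear (fun x => inf (S x)).
    apply: sublinear_inf => // [y z _ _ [t /= t0 <-] [s /= s0 <-]|a y _ a0 [t /= t0 <-]].
      exists (f (y + z + (t + s) *: x0) - (t + s) * f x0).
        by exists (t + s) => //=; exact: addr_ge0.
      rewrite scalerDl addrACA; have := sq.1 (y + t *: x0) (z + s *: x0); lra.
    exists (f (a *: y + (a * t) *: x0) - (a * t) * f x0).
      by exists (a * t) => //=; exact: mulr_ge0.
    by rewrite -scalerA -scalerDr sublinearZ//; lra.
  have Sf y : inf (S y) <= f y.
    apply: (ge_inf (proj2 (Sinf y))); exists 0 => //=.
    by rewrite scale0r addr0 mul0r subr0.
  have Sp y : inf (S y) <= p y by exact: le_trans (Sf y) (qp y).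
  have := qmin (mkQ _ (conj sS Sp)) (asboolT Sf).
  move=> /(congr1 (fun r : Q => sval r x)) /= Sx; rewrite -lerBrDr.
  rewrite /f -Sx; apply: (ge_inf (proj2 (Sinf x))).
  by exists 1 => //=; rewrite scale1r mul1r.
have fDE x y : f (x + y) = f x + f y.
  by apply/eqP; rewrite eq_le fD sq.1.
have fN x : f (- x) = - f x.
  by apply/eqP; rewrite -addr_eq0 -fDE addNr sublinear0.
have flin : linear (f : V -> R^o).
  move=> a x y; rewrite fDE; congr (_ + _); have [a0|a0] := leP 0 a.
    exact: sublinearZ.
  rewrite -[a]opprK scaleNr fN sublinearZ ?oppr_ge0 ?ltW//.
  by rewrite [RHS]scaleNr.
pose fL : {linear V -> R^o} :=
  HB.pack (f : V -> R^o) (GRing.isLinear.Build R V R^o *:%R f flin).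
by exists fL.
Qed.

Lemma bl_norm_le_bound {R : realType} {X Y : normedModType R} (f : BL X Y) M :
  0 <= M -> (forall x, `|f x| <= M * `|x|) -> `|f| <= M.
Proof.
move=> M0 fM; apply: opnorm_le => x x1; apply: le_trans (fM x) _.
by rewrite ler_piMr.
Qed.

Lemma bl_le {R : realType} {X Y : normedModType R} (f : BL X Y) M x :
  `|f| <= M -> `|f x| <= M * `|x|.
Proof. by move=> fM; apply: le_trans (bl_norm_le f x) _; rewrite ler_wpM2r. Qed.

(** The theorem of Hahn and Banach for a linear relation $W$ in place of a
    functional on a subspace: the bound forces $W$ to be single valued. It is
    applied to $p (x) = \inf_{W w c} (M \|x - w\| + c)$. *)
Lemma hahn_banach_relation {R : realType} {V : normedModType R}
    (W : V -> R -> Prop) (M : R) : 0 <= M -> W 0 0 ->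
  (forall a x y c d, W x c -> W y d -> W (a *: x + y) (a * c + d)) ->
  (forall x c, W x c -> `|c| <= M * `|x|) ->
  exists2 f : dual V, `|f| <= M & forall x c, W x c -> f x = c.
Proof.
move=> M0 W0 Wlin WM.
pose S x := [set r | exists w c, W w c /\ r = M * `|x - w| + c].
have Sinf x : has_inf (S x).
  split; first by exists (M * `|x - 0| + 0), 0, 0.
  exists (- (M * `|x|)) => _ [w [c [Wc ->]]].
  have := WM _ _ Wc; rewrite ler_norml => /andP[+ _].
  have : M * `|w| <= M * (`|x - w| + `|x|).
    by rewrite ler_wpM2l// -[in leLHS](subKr x w) (le_trans (ler_normB _ _))// addrC.
  by rewrite mulrDr; lra.
have SS : sublinear (fun x => inf (S x)).
  apply: sublinear_inf => //.
    move=> x y _ _ [w [c [Wc ->]]] [z [d [Wd ->]]].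
    exists (M * `|x + y - (w + z)| + (c + d)).
      exists (w + z), (c + d); split=> //.
      by have := Wlin 1 _ _ _ _ Wc Wd; rewrite scale1r mul1r.
    rewrite addrACA lerD2r -mulrDr ler_wpM2l// opprD addrACA.
    exact: ler_normD.
  move=> a x _ a0 [w [c [Wc ->]]].
  exists (M * `|a *: x - a *: w| + a * c).
    exists (a *: w), (a * c); split=> //.
    by have := Wlin a _ _ _ _ Wc W0; rewrite !addr0.
  by rewrite -scalerBr normrZ ger0_norm// mulrCA mulrDr.
have [f fS] := hahn_banach SS.
have fM x : f x <= M * `|x|.
  apply: le_trans (fS x) _; apply: (ge_inf (proj2 (Sinf x))).
  by exists 0, 0; rewrite subr0 addr0.
have fM' x : `|f x| <= M * `|x|.
  rewrite ler_norml fM andbT lerNl -[- f x]linearN.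
  by apply: le_trans (fM _) _; rewrite normrN.
have fb : (f : V -> R^o) \in bounded_linear V R^o.
  apply/bounded_linearP; split; last by exists M.
  by move=> a x y; rewrite linearP.
exists (MkBL fb); first exact: bl_norm_le_bound.
have fle x c : W x c -> f x <= c.
  move=> Wc; apply: le_trans (fS x) _; apply: (ge_inf (proj2 (Sinf x))).
  by exists x, c; split=> //; rewrite subrr normr0 mulr0 add0r.
move=> x c Wc /=; apply/eqP; rewrite eq_le fle//= -lerN2 -[- f x]linearN.
apply: fle; have := Wlin (-1) _ _ _ _ Wc W0.
by rewrite !addr0 scaleN1r mulN1r.
Qed.

Lemma norming_functional {R : realType} {V : normedModType R} (y : V) :
  exists2 f : dual V, `|f| <= 1 & f y = `|y|.
Proof.
have [||||f f1 fy] := @hahn_banach_relation R V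
  (fun x c => exists t, x = t *: y /\ c = t * `|y|) 1.
- by [].
- by exists 0; rewrite scale0r mul0r.
- move=> a _ _ _ _ [t [-> ->]] [s [-> ->]]; exists (a * t + s).
  by rewrite scalerDl scalerA mulrDl mulrA.
- by move=> _ _ [t [-> ->]]; rewrite mul1r normrM normrZ normr_id.
by exists f => //; apply: fy; exists 1; rewrite scale1r mul1r.
Qed.

(** The relation $t y + z \mapsto t \|y\|$, $z \in Z$, is bounded by $1$ because
    $y$ is orthogonal to $Z$. *)
Lemma bj_orth_functional {R : realType} {V : normedModType R} (y : V)
    (Z : set V) : linear_subspace Z -> bj_orth_set y Z ->
  exists2 f : dual V, `|f| <= 1 & f y = `|y| /\ annihilator Z f.
Proof.
move=> [Z0 ZD] yZ.
have [||||f f1 fy] := @hahn_banach_relation R V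
  (fun x c => exists t z, [/\ Z z, x = t *: y + z & c = t * `|y|]) 1.
- by [].
- by exists 0, 0; split=> //; rewrite ?scale0r ?addr0 ?mul0r.
- move=> a _ _ _ _ [t [z [Zz -> ->]]] [s [z' [Zz' -> ->]]].
  exists (a * t + s), (a *: z + z'); split; first exact: ZD.
    by rewrite scalerDr scalerA scalerDl addrACA.
  by rewrite mulrDl mulrA.
- move=> _ _ [t [z [Zz -> ->]]]; rewrite mul1r normrM normr_id.
  have [->|t0] := eqVneq t 0; first by rewrite normr0 mul0r.
  have -> : t *: y + z = t *: (y + t^-1 *: z).
    by rewrite scalerDr scalerA mulfV// scale1r.
  by rewrite normrZ ler_wpM2l// yZ.
exists f => //; split.
  by apply: fy; exists 1, 0; split=> //; rewrite ?scale1r ?addr0 ?mul1r.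
move=> z Zz; apply: fy; exists 0, z; split=> //; last by rewrite mul0r.
by rewrite scale0r add0r.
Qed.

(** * Lattice theory of the positive cone *)

Lemma dual_eq {R : realType} {X : normedModType R} (x y : X) :
  (forall f : dual X, f x = f y) -> x = y.
Proof.
move=> xy; apply/eqP; rewrite -subr_eq0 -normr_eq0; apply/eqP.
by have [f _ <-] := norming_functional (x - y); rewrite linearB/= xy subrr.
Qed.

Lemma dual_linearE {R : realType} {X : normedModType R} (f : dual X) :
  (forall x y, f (x + y) = f x + f y) * (forall x, f (- x) = - f x) *
  (forall (a : R) x, f (a *: x) = a * f x) * (f 0 = 0).
Proof.
by do !split=> *; rewrite (linearD, linearN, linearZ, linear0).
Qed.

(** Identities between vectors are checked on all functionals, where they
    become identities between real numbers. *)
Ltac vec := apply: dual_eq => ?; rewrite ?dual_linearE; by field.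

(** The order structure of an abstract L1-space, presented by its positive cone
    and by the positive part of a vector. *)
Record L1_cone {R : realType} {X : normedModType R}
    (P : X -> Prop) (pos : X -> X) : Prop := L1Cone {
  cone_add : forall x y, P x -> P y -> P (x + y) ;
  cone_scale : forall (a : R) x, 0 <= a -> P x -> P (a *: x) ;
  cone_norm : forall x y, P x -> P y -> `|x + y| = `|x| + `|y| ;
  pos_cone : forall x, P (pos x) ;
  pos_ge : forall x, P (pos x - x) ;
  pos_least : forall x z, P z -> P (z - x) -> P (z - pos x) ;
  pos_norm : forall x, `|x| = `|pos x| + `|pos x - x| }.

Section ConeTheory.
Context {R : realType} {X : normedModType R} {P : X -> Prop} {pos : X -> X}
  (hP : L1_cone P pos).

Let addP := cone_add hP.
Let scaleP := cone_scale hP.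

Lemma cone0 : P 0.
Proof. by rewrite -(scale0r (pos 0)); apply: scaleP; last exact: pos_cone hP _. Qed.

Lemma cone_cast x y : P x -> x = y -> P y.
Proof. by move=> + <-. Qed.

Lemma cone_norm_le a b : P a -> P (b - a) -> `|a| <= `|b|.
Proof.
move=> Pa Pba; rewrite -[b](subrK a) (cone_norm hP)//.
by rewrite lerDr.
Qed.

Lemma cone_eq0 x : P x -> P (- x) -> x = 0.
Proof.
move=> Px PNx; have := cone_norm hP Px PNx.
rewrite subrr normr0 normrN => x0; apply/eqP; rewrite -normr_eq0; apply/eqP.
by have := normr_ge0 x; lra.
Qed.

Lemma cone_antisym x y : P (x - y) -> P (y - x) -> x = y.
Proof.
move=> xy yx; apply/eqP; rewrite -subr_eq0; apply/eqP; apply: cone_eq0 => //.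
by rewrite opprB.
Qed.

Lemma cone_trans y x z : P (y - x) -> P (z - y) -> P (z - x).
Proof. by move=> xy yz; apply: cone_cast (addP xy yz) _; vec. Qed.

Lemma pos_id x : P x -> pos x = x.
Proof.
move=> Px; apply: cone_antisym; first exact: pos_ge hP _.
by apply: pos_least hP _ _ _ _ => //; rewrite subrr; exact: cone0.
Qed.

Definition modulus x := pos x + (pos x - x).

Lemma modulus_cone x : P (modulus x).
Proof. by apply: addP; [exact: pos_cone hP _ | exact: pos_ge hP _]. Qed.

Lemma modulus_norm x : `|modulus x| = `|x|.
Proof.
rewrite /modulus (cone_norm hP) ?(pos_norm hP x)//.
- exact: pos_cone hP _.
- exact: pos_ge hP _.
Qed.

Lemma modulus_ge x : P (modulus x - x).
Proof.
have := pos_ge hP x => Px; apply: cone_cast (addP Px Px) _.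
by rewrite /modulus; vec.
Qed.

Lemma modulus_geN x : P (modulus x + x).
Proof.
have := pos_cone hP x => Px; apply: cone_cast (addP Px Px) _.
by rewrite /modulus; vec.
Qed.

Lemma modulus_least x w : P (w - x) -> P (w + x) -> P (w - modulus x).
Proof.
move=> wx wNx; have h2 : (0 : R) <= 2^-1 by rewrite invr_ge0.
have : P (2^-1 *: (w + x) - pos x).
  apply: (pos_least hP); first exact: scaleP.
  by apply: cone_cast (scaleP h2 wx) _; vec.
by move=> Pw; apply: cone_cast (addP Pw Pw) _; rewrite /modulus; vec.
Qed.

Lemma cone_norm_between x w : P (w - x) -> P (w + x) -> `|x| <= `|w|.
Proof.
move=> wx wNx; rewrite -[leLHS]modulus_norm; apply: cone_norm_le.
  exact: modulus_cone.
exact: modulus_least.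
Qed.

Lemma modulusD x y : P (modulus x + modulus y - modulus (x + y)).
Proof.
apply: modulus_least.
  by apply: cone_cast (addP (modulus_ge x) (modulus_ge y)) _; vec.
by apply: cone_cast (addP (modulus_geN x) (modulus_geN y)) _; vec.
Qed.

Lemma modulusZ a x : P (`|a| *: modulus x - modulus (a *: x)).
Proof.
have [a0|a0] := ger0P a; apply: modulus_least.
- by apply: cone_cast (scaleP a0 (modulus_ge x)) _; vec.
- by apply: cone_cast (scaleP a0 (modulus_geN x)) _; vec.
- have Na0 : 0 <= - a by rewrite oppr_ge0 ltW.
  by apply: cone_cast (scaleP Na0 (modulus_geN x)) _; vec.
- have Na0 : 0 <= - a by rewrite oppr_ge0 ltW.
  by apply: cone_cast (scaleP Na0 (modulus_ge x)) _; vec.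
Qed.

Lemma modulus_id x : P x -> modulus x = x.
Proof. by move=> Px; rewrite /modulus (pos_id Px) subrr addr0. Qed.

Definition meet a b := a - pos (a - b).

Lemma meet_lel a b : P (a - meet a b).
Proof. by apply: cone_cast (pos_cone hP (a - b)) _; rewrite /meet; vec. Qed.

Lemma meet_ler a b : P (b - meet a b).
Proof. by apply: cone_cast (pos_ge hP (a - b)) _; rewrite /meet; vec. Qed.

Lemma meet_glb z a b : P (a - z) -> P (b - z) -> P (meet a b - z).
Proof.
move=> az bz; have bz' : P (a - z - (a - b)) by apply: cone_cast bz _; vec.
by apply: cone_cast (pos_least hP az bz') _; rewrite /meet; vec.
Qed.

Lemma meet_ge0 a b : P a -> P b -> P (meet a b).
Proof.
by move=> Pa Pb; rewrite -[meet a b]subr0; apply: meet_glb; rewrite subr0.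
Qed.

Lemma meetC a b : meet a b = meet b a.
Proof.
by apply: cone_antisym; apply: meet_glb; first [exact: meet_lel | exact: meet_ler].
Qed.

Lemma meet_mono a b a' b' : P (a' - a) -> P (b' - b) ->
  P (meet a' b' - meet a b).
Proof.
move=> aa bb; apply: meet_glb.
  exact: cone_trans (meet_lel a b) aa.
exact: cone_trans (meet_ler a b) bb.
Qed.

Lemma meet_scale c a b : 0 <= c -> P a -> P b ->
  P (c *: meet a b - meet (c *: a) (c *: b)).
Proof.
move=> c0 Pa Pb; have [->|cN0] := eqVneq c 0.
  rewrite !scale0r /meet !subrr pos_id ?subrr; exact: cone0.
have ci : 0 <= c^-1 by rewrite invr_ge0.
have : P (meet a b - c^-1 *: meet (c *: a) (c *: b)).
  apply: meet_glb.
    by apply: cone_cast (scaleP ci (meet_lel (c *: a) (c *: b))) _; vec.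
  by apply: cone_cast (scaleP ci (meet_ler (c *: a) (c *: b))) _; vec.
by move=> /(scaleP c0) Pm; apply: cone_cast Pm _; vec.
Qed.

(** With $t = (a + b) \wedge c$, both $t - a \le b$ and $t - a \le c$. *)
Lemma meetD a b c : P a -> P b -> P c ->
  P (meet a c + meet b c - meet (a + b) c).
Proof.
move=> Pa Pb Pc; set t := meet (a + b) c.
have tb : P (meet b c - (t - a)).
  apply: meet_glb; first by apply: cone_cast (meet_lel (a + b) c) _; rewrite -/t; vec.
  by apply: cone_cast (addP (meet_ler (a + b) c) Pa) _; rewrite -/t; vec.
have wP : P (a - t + meet b c) by apply: cone_cast tb _; vec.
have wac : P (a - t + meet b c - (a - c)).
  by apply: cone_cast (addP (meet_ler (a + b) c) (meet_ge0 Pb Pc)) _; rewrite -/t; vec.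
by apply: cone_cast (pos_least hP wP wac) _; rewrite [meet a c]/meet; vec.
Qed.

(** In a lattice, $||a| - |b|| = |a| + |b| - 2 (|a| \wedge |b|)$, and the left
    side is at most $|a + b|$. So two vectors behave like vectors of an
    $\ell^1$-sum up to the size of their overlap. *)
Lemma norm_add_ge a b p q : P (p - a) -> P (p + a) -> P (q - b) -> P (q + b) ->
  `|a| + `|b| <= `|a + b| + 2 * `|meet p q|.
Proof.
move=> pa pNa qb qNb; set A := modulus a; set B := modulus b.
set z := A - B; set t := meet A B; set w := modulus (a + b).
have modN x : modulus (- x) = modulus x.
  have le x' : P (modulus x' - modulus (- x')).
    apply: modulus_least; last exact: modulus_ge.
    by apply: cone_cast (modulus_geN x') _; vec.
  by apply: cone_antisym => //; have := le (- x); rewrite opprK.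
have tri x y : P (modulus (x + y) + modulus y - modulus x).
  by apply: cone_cast (modulusD (x + y) (- y)) _; rewrite addrK modN.
have zw : `|z| <= `|a + b|.
  rewrite -[leRHS]modulus_norm -/w; apply: cone_norm_between.
    by apply: cone_cast (tri a b) _; rewrite -/A -/B -/w /z; vec.
  apply: cone_cast (tri b a) _; rewrite [b + a]addrC -/A -/B -/w /z; vec.
have PA := modulus_cone a; have PB := modulus_cone b.
have Pt : P t by exact: meet_ge0.
have nA : `|a| = `|t| + `|pos z|.
  rewrite -[LHS]modulus_norm -(cone_norm hP)//; last exact: pos_cone hP _.
  by congr `|_|; rewrite /t /meet -/z -/A; vec.
have nB : `|b| = `|t| + `|pos z - z|.
  rewrite -[LHS]modulus_norm -(cone_norm hP)//; last exact: pos_ge hP _.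
  by congr `|_|; rewrite /t /meet -/z -/B [in RHS]/z; vec.
have tm : `|t| <= `|meet p q|.
  by apply: cone_norm_le => //; apply: meet_mono; exact: modulus_least.
have := pos_norm hP z; lra.
Qed.

(** If $z \ge 0$ then the negative part of $x$ is at most $|z - x|$. *)
Lemma cone_closed x :
  (forall e : R, 0 < e -> exists2 z, P z & `|z - x| <= e) -> P x.
Proof.
move=> near; suff n0 : pos (- x) = 0.
  by have := pos_ge hP (- x); rewrite n0 sub0r opprK.
apply/eqP; rewrite -normr_le0; apply/ler_addgt0Pr => e e0.
rewrite add0r; have [z Pz ze] := near _ e0; apply: le_trans ze.
rewrite -[leRHS]modulus_norm; apply: cone_norm_le; first exact: pos_cone hP _.
apply: pos_least hP _ _ _ _; first exact: modulus_cone.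
by apply: cone_cast (addP (modulus_ge (z - x)) Pz) _; vec.
Qed.

End ConeTheory.

(** * Atoms and L-summands *)

Definition L_projection {R : realType} {X : normedModType R}
    (e : X) (phi : dual X) :=
  [/\ `|e| = 1, phi e = 1 & forall x, `|x| = `|phi x| + `|x - phi x *: e|].

Section Atoms.
Context {R : realType} {X : normedModType R} {P : X -> Prop} {pos : X -> X}
  (hP : L1_cone P pos).

Let addP := cone_add hP.
Let scaleP := cone_scale hP.
Let P0 := cone0 hP.
Local Notation meet := (@meet R X pos).
Local Notation modulus := (@modulus R X pos).

Definition atom (e : X) :=
  [/\ P e, `|e| = 1 & forall u, P u -> P (e - u) -> exists c : R, u = c *: e].

Lemma cone_scale_ge0 c e : P e -> `|e| != 0 -> P (c *: e) -> 0 <= c.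
Proof.
move=> Pe e0 Pce; rewrite leNgt; apply/negP => c0.
have NP : P (- (c *: e)).
  by rewrite -scaleNr; apply: scaleP => //; rewrite oppr_ge0 ltW.
have := cone_eq0 hP Pce NP => /eqP; rewrite scaler_eq0 lt_eqF//=.
by rewrite -normr_eq0 (negbTE e0).
Qed.

Lemma meet0_le a b a' b' : P a' -> P b' -> P (a - a') -> P (b - b') ->
  meet a b = 0 -> meet a' b' = 0.
Proof.
move=> Pa Pb aa bb ab0; apply: (cone_eq0 hP); first exact: (meet_ge0 hP).
by have := meet_mono hP aa bb; rewrite ab0 sub0r.
Qed.

Lemma meet0_scale c a b : 0 <= c -> P a -> P b -> meet a b = 0 ->
  meet (c *: a) b = 0.
Proof.
move=> c0 Pa Pb ab0; have c1 : 0 <= c + 1 by rewrite addr_ge0.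
have : meet ((c + 1) *: a) ((c + 1) *: b) = 0.
  apply: (cone_eq0 hP).
    by apply: (meet_ge0 hP) => //; exact: scaleP.
  by have := meet_scale hP c1 Pa Pb; rewrite ab0 scaler0 sub0r.
apply: meet0_le => //; first exact: scaleP.
  by apply: (cone_cast (P := P) Pa); vec.
by apply: (cone_cast (P := P) (scaleP c0 Pb)); vec.
Qed.

Lemma meet0D a b c : P a -> P b -> P c -> meet a c = 0 -> meet b c = 0 ->
  meet (a + b) c = 0.
Proof.
move=> Pa Pb Pc ac bc; apply: (cone_eq0 hP).
  by apply: (meet_ge0 hP) => //; exact: addP.
by have := meetD hP Pa Pb Pc; rewrite ac bc addr0 sub0r.
Qed.

Lemma meet_pos x : meet (pos x) (pos x - x) = 0.
Proof. by rewrite /meet subKr subrr. Qed.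

(** An atom $e$ spans an L-summand. For positive $x$ and $n > \|x\|$ the vector
    $x \wedge n e$ lies under a multiple of $e$, hence equals $c e$ with
    $c \le \|x\| < n$; the remainder $x - c e$ is then disjoint from $e$. *)
Lemma atom_L_projection e : atom e -> exists phi, L_projection e phi.
Proof.
move=> [Pe e1 eR]; pose D r := meet (modulus r) e = 0.
have multP c r : D r -> `|c *: e + r| = `|c| + `|r|.
  move=> Dr; apply/eqP; rewrite eq_le; apply/andP; split.
    by rewrite (le_trans (ler_normD _ _))// normrZ e1 mulr1.
  have ce0 : meet (`|c| *: e) (modulus r) = 0.
    by apply: meet0_scale => //; [exact: modulus_cone | rewrite (meetC hP)].
  have := @norm_add_ge _ _ _ _ hP (c *: e) r (`|c| *: e) (modulus r).
  rewrite ce0 normr0 mulr0 addr0 normrZ e1 mulr1; apply.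
  - by rewrite -scalerBl; apply: scaleP => //; rewrite subr_ge0 ler_norm.
  - by rewrite -scalerDl; apply: scaleP => //; rewrite -lerBlDr sub0r -normrN ler_norm.
  - exact: (modulus_ge hP).
  - exact: (modulus_geN hP).
have D0 : D 0.
  rewrite /D (modulus_id hP P0); apply: (cone_eq0 hP); first exact: (meet_ge0 hP).
  by have := meet_lel hP 0 e; rewrite sub0r.
have Dlin a r s : D r -> D s -> D (a *: r + s).
  move=> Dr Ds; have Pr := modulus_cone hP r; have Ps := modulus_cone hP s.
  have Par : P (`|a| *: modulus r) by exact: scaleP.
  apply: (@meet0_le (`|a| *: modulus r + modulus s) e) => //.
  - exact: (modulus_cone hP).
  - apply: cone_trans hP _ _ _ (modulusD hP _ _) _.
    by apply: (cone_cast (P := P) (modulusZ hP a r)); vec.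
  - by rewrite subrr.
  - by apply: meet0D => //; exact: meet0_scale.
have Dpos x : P x -> exists c, D (x - c *: e).
  move=> Px; set n := `|x| + 1; have n0 : 0 <= n by rewrite addr_ge0.
  have Pne : P (n *: e) by exact: scaleP.
  set u := meet x (n *: e); have Pu : P u by exact: (meet_ge0 hP).
  have eqR v : P v -> P (n *: e - v) -> exists2 c, 0 <= c & v = c *: e.
    have nN0 : n != 0 by rewrite gt_eqF// ltr_wpDl.
    move=> Pv Pnv; have ni : 0 <= n^-1 by rewrite invr_ge0.
    have [||c vc] := eR (n^-1 *: v); first exact: scaleP.
      by apply: (cone_cast (P := P) (scaleP ni Pnv)); vec.
    have {}vc : v = (n * c) *: e by rewrite -scalerA -vc scalerA mulfV// scale1r.
    by exists (n * c) => //; apply: (cone_scale_ge0 Pe); rewrite ?e1 -?vc ?oner_eq0.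
  have [|c c0 uc] := eqR u Pu; first exact: (meet_ler hP).
  set r := x - c *: e.
  have Pr : P r by rewrite /r -uc; exact: (meet_lel hP).
  have cx : c <= `|x|.
    rewrite -[c]ger0_norm// -[leLHS]mulr1 -e1 -normrZ -uc.
    by apply: (cone_norm_le hP) => //; exact: (meet_lel hP).
  exists c; rewrite /D (modulus_id hP Pr).
  set t := meet r e; have Pt : P t by exact: (meet_ge0 hP).
  have [s [s0 s1 ts]] : exists s, [/\ 0 <= s, s <= 1 & t = s *: e].
    have [|s ts] := eR t Pt; first exact: (meet_ler hP).
    have s0 : 0 <= s by apply: (cone_scale_ge0 Pe); rewrite ?e1 -?ts ?oner_eq0.
    exists s; split=> //; rewrite -[s]ger0_norm// -[leLHS]mulr1 -e1 -normrZ -ts.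
    by apply: (cone_norm_le hP) => //; exact: (meet_ler hP).
  have : P (u - (c *: e + t)).
    apply: (meet_glb hP) => //.
      by apply: (cone_cast (P := P) (meet_lel hP r e)); rewrite -/t /r; vec.
    rewrite ts -scalerDl -scalerBl; apply: scaleP => //.
    by rewrite subr_ge0 /n lerD.
  by rewrite uc opprD addNKr => /(cone_eq0 hP Pt).
have Dall x : exists c, D (x - c *: e).
  have [c Dc] := Dpos _ (pos_cone hP x); have [d Dd] := Dpos _ (pos_ge hP x).
  exists (c - d); have := Dlin (-1) _ _ Dd Dc.
  by congr D; vec.
have [||||phi _ phiE] := @hahn_banach_relation R X (fun x c => D (x - c *: e)) 1.
- by [].
- by rewrite scale0r subrr.
- move=> a x y c d Dx Dy; have := Dlin a _ _ Dx Dy.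
  by congr D; vec.
- move=> x c Dx; rewrite mul1r -[x in leRHS](subrK (c *: e)) addrC multP//.
  by rewrite lerDl.
exists phi; split => //.
  by apply: phiE; rewrite scale1r subrr.
move=> x; have [c Dc] := Dall x; rewrite (phiE _ _ Dc).
by rewrite -multP// addrC subrK.
Qed.
End Atoms.

Arguments atom {R X} P e.

(** * Splitting of positive vectors and almost disjoint sequences *)

Section Splitting.
Context {R : realType} {X : normedModType R} {P : X -> Prop} {pos : X -> X}
  (hP : L1_cone P pos).

Let addP := cone_add hP.
Let scaleP := cone_scale hP.
Let P0 := cone0 hP.
Local Notation meet := (@meet R X pos).

Lemma meet0_under k a b b' : P a -> P b -> P b' -> 0 <= k -> P (k *: b - b') ->
  meet a b = 0 -> meet a b' = 0.
Proof.
move=> Pa Pb Pb' k0 kb ab0; apply: (@meet0_le _ _ _ _ hP a (k *: b)) => //.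
- by rewrite subrr.
- by rewrite (meetC hP); apply: (meet0_scale hP) => //; rewrite (meetC hP).
Qed.

(** If $0 \le u \le e$ is not a multiple of $e$, some $u - c e$ has non-zero
    positive and negative parts: otherwise $u$ would be comparable with every
    multiple of $e$, hence equal to $c e$ for the largest $c$ with
    $c e \le u$. *)
Lemma split_of_not_atom e : P e -> `|e| = 1 -> ~ atom P e ->
  exists a b, [/\ P a, P b, a != 0, b != 0 & meet a b = 0] /\
    P (e - a) /\ exists2 c, 0 <= c & P (c *: e - b).
Proof.
move=> Pe e1 natom.
have [u [Pu ue uR]] : exists u, [/\ P u, P (e - u) & forall c : R, u <> c *: e].
  apply: contrapT => nu; apply: natom; split=> // u Pu ue.
  apply: contrapT => uR; apply: nu; exists u; split=> // c uc.
  by apply: uR; exists c.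
have [c [a0 b0]] : exists c, pos (u - c *: e) <> 0 /\
    pos (u - c *: e) - (u - c *: e) <> 0.
  apply: contrapT => nc.
  pose S := [set c | P (u - c *: e)].
  have Sub c : S c -> c <= `|u|.
    move=> Sc; have [c0|/ltW c0] := leP 0 c; last exact: le_trans c0 _.
    rewrite -[c]ger0_norm// -[leLHS]mulr1 -e1 -normrZ.
    by apply: (cone_norm_le hP) => //; exact: scaleP.
  have Ssup : has_sup S.
    split; first by exists 0; rewrite /S/= scale0r subr0.
    by exists `|u| => c; exact: Sub.
  apply: (uR (sup S)); apply: (cone_antisym hP); apply: (cone_closed hP) => d d0.
    have [c Sc cd] := sup_adherent d0 Ssup; exists (u - c *: e) => //.
    have -> : u - c *: e - (u - sup S *: e) = (sup S - c) *: e by vec.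
    rewrite normrZ e1 mulr1 ger0_norm; first lra.
    by rewrite subr_ge0; exact: sup_upper_bound.
  exists ((sup S + d) *: e - u).
    have [Sc|nSc] := pselect (S (sup S + d)).
      by have := sup_upper_bound Ssup Sc; lra.
    have [p0|pN0] := pselect (pos (u - (sup S + d) *: e) = 0).
      have := pos_ge hP (u - (sup S + d) *: e).
      by rewrite p0 sub0r opprB.
    exfalso; apply: nc; exists (sup S + d); split=> // /eqP.
    rewrite subr_eq0 => /eqP pe; apply: nSc; rewrite /S/= -pe.
    exact: pos_cone hP _.
  have -> : (sup S + d) *: e - u - (sup S *: e - u) = d *: e by vec.
  by rewrite normrZ e1 mulr1 ger0_norm// ltW.
have c0 : 0 <= c.
  rewrite leNgt; apply/negP => c0; apply: b0.
  have Nc0 : 0 <= - c by rewrite oppr_ge0 ltW.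
  rewrite (pos_id hP) ?subrr//.
  by apply: (cone_cast (P := P) (addP Pu (scaleP Nc0 Pe))); vec.
have ua : P (u - pos (u - c *: e)).
  apply: (pos_least hP) => //; apply: (cone_cast (P := P) (scaleP c0 Pe)); vec.
exists (pos (u - c *: e)), (pos (u - c *: e) - (u - c *: e)); split; first split.
- exact: pos_cone hP _.
- exact: pos_ge hP _.
- exact/eqP.
- exact/eqP.
- exact: meet_pos.
split; first exact: (cone_trans hP ua ue).
by exists c => //; apply: (cone_cast (P := P) ua); vec.
Qed.

End Splitting.

Section AlmostDisjoint.
Context {R : realType} {X : normedModType R} {P : X -> Prop} {pos : X -> X}
  (hP : L1_cone P pos).

Let addP := cone_add hP.
Let scaleP := cone_scale hP.
Let P0 := cone0 hP.
Local Notation meet := (@meet R X pos).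

Lemma cone_sum (n : nat) (v : nat -> X) : (forall i, (i < n)%N -> P (v i)) ->
  P (\sum_(i < n) v i).
Proof. by move=> Pv; elim/big_ind: _ => // i _; exact: Pv. Qed.

Context (v : nat -> X) (Pv : forall n, P (v n)) (v1 : forall n, `|v n| = 1)
  (v_meet : forall n, `|meet (\sum_(i < n) v i) (v n)| <= 2^-1 ^+ n / 8).

(** Each new vector overlaps the sum of the previous ones by at most
    $2^{-n}/8$, and these numbers add up to at most $1/4$. *)
Lemma almost_disjoint_l1 n (c : nat -> R) :
  \sum_(i < n) `|c i| <= 2 * `|\sum_(i < n) c i *: v i|.
Proof.
set C := \sum_(i < n) `|c i|.
have C0 : 0 <= C by exact: sumr_ge0.
have cC i : (i < n)%N -> `|c i| <= C.
  move=> ltin; rewrite /C (bigD1 (Ordinal ltin))//= lerDl; exact: sumr_ge0.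
suff H m : (m <= n)%N -> \sum_(i < m) `|c i| <=
    `|\sum_(i < m) c i *: v i| + C / 2 * (1 - 2^-1 ^+ m).
  have := H n (leqnn n); rewrite -/C.
  have : 0 <= C / 2 * (2^-1 : R) ^+ n by rewrite mulr_ge0 ?exprn_ge0 ?divr_ge0.
  by rewrite mulrBr mulr1; lra.
elim: m => [_|m IHm ltmn].
  by rewrite !big_ord0 normr0 expr0 subrr mulr0 addr0.
rewrite !big_ord_recr/=; set a := \sum_(i < m) c i *: v i.
set y := \sum_(i < m) v i; have Py : P y by exact: cone_sum.
have CyE s : C *: y + s *: a = \sum_(i < m) (C + s * c i) *: v i.
  rewrite /y /a !scaler_sumr -big_split; apply: eq_bigr => i _ /=.
  by rewrite scalerDl scalerA.
have Cc i : (i < n)%N -> 0 <= C + c i /\ 0 <= C - c i.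
  by move=> /cC; rewrite ler_norml => /andP[]; lra.
have ltin i : (i < m)%N -> (i < n)%N by move=> im; exact: ltn_trans im ltmn.
have := @norm_add_ge _ _ _ _ hP a (c m *: v m) (C *: y) (C *: v m).
rewrite normrZ v1 mulr1 => H.
have {}H : `|a| + `|c m| <=
    `|a + c m *: v m| + 2 * `|meet (C *: y) (C *: v m)|.
  apply: H.
  - rewrite -scaleN1r CyE.
    apply: (@cone_sum m (fun i => (C + -1 * c i) *: v i)) => i im.
    apply: scaleP => //.
    by have := Cc _ (ltin _ im); rewrite mulN1r; lra.
  - rewrite -[a]scale1r CyE.
    apply: (@cone_sum m (fun i => (C + 1 * c i) *: v i)) => i im.
    apply: scaleP => //.
    by have := Cc _ (ltin _ im); rewrite mul1r; lra.
  - by rewrite -scalerBl; apply: scaleP => //; have [] := Cc _ ltmn.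
  - by rewrite -scalerDl; apply: scaleP => //; have [] := Cc _ ltmn.
have mC : `|meet (C *: y) (C *: v m)| <= C * (2^-1 ^+ m / 8).
  apply: (@le_trans _ _ (C * `|meet y (v m)|)); last by rewrite ler_wpM2l ?v_meet.
  rewrite -[C in leRHS]ger0_norm// -normrZ; apply: (cone_norm_le hP).
    by apply: (meet_ge0 hP); exact: scaleP.
  exact: (meet_scale hP).
have := IHm (ltnW ltmn); rewrite -/a exprS; move: H mC; rewrite -/a.
have : 0 <= C * 2^-1 ^+ m by rewrite mulr_ge0 ?exprn_ge0.
set t := (2^-1 ^+ m : R); nra.
Qed.

(** The relation $\sum c_i v_i \mapsto \sum c_i b_i$ is bounded by $2$ because
    the $v_i$ span $\ell^1$ up to this factor. *)
Lemma almost_disjoint_interpolation (b : nat -> R) : (forall i, `|b i| <= 1) ->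
  exists g : dual X, forall i, g (v i) = b i.
Proof.
move=> b1.
(* Finite sums are indexed by all large n, so that two of them share a range. *)
pose W (x : X) (d : R) := exists n0 (c : nat -> R), forall n, (n0 <= n)%N ->
  x = \sum_(i < n) c i *: v i /\ d = \sum_(i < n) c i * b i.
have [||||g _ gW] := @hahn_banach_relation R X W 2.
- by [].
- exists 0, (fun=> 0) => n _; split.
    by rewrite big1// => i _; rewrite scale0r.
  by rewrite big1// => i _; rewrite mul0r.
- move=> a x y c d [n0 [cx xE]] [n1 [cy yE]].
  exists (maxn n0 n1), (fun i => a * cx i + cy i) => n.
  rewrite geq_max => /andP[/xE[-> ->] /yE[-> ->]]; split.
    rewrite scaler_sumr -big_split; apply: eq_bigr => i _ /=.
    by rewrite scalerDl scalerA.
  rewrite mulr_sumr -big_split; apply: eq_bigr => i _ /=.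
  by rewrite mulrDl mulrA.
- move=> x d [n [c /(_ n (leqnn n))[-> ->]]].
  apply: le_trans (almost_disjoint_l1 n c).
  apply: le_trans (ler_norm_sum _ _ _) _; apply: ler_sum => i _.
  by rewrite normrM ler_piMr.
exists g => i; apply: gW; exists i.+1, (fun j => (j == i)%:R) => n ltin.
rewrite (bigD1 (Ordinal ltin))//= eqxx scale1r big1 ?addr0; last first.
  by move=> j ji; rewrite (_ : (_ == _) = false) ?scale0r//; exact/negbTE.
rewrite (bigD1 (Ordinal ltin))//= eqxx mul1r big1 ?addr0// => j ji.
by rewrite (_ : (_ == _) = false) ?mul0r//; exact/negbTE.
Qed.

End AlmostDisjoint.

(** * Vectors at which a functional nearly attains its norm *)

Section Exhaustion.
Context {R : realType} {X : completeNormedModType R} {P : X -> Prop}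
  {pos : X -> X} (hP : L1_cone P pos).

Let addP := cone_add hP.
Let P0 := cone0 hP.
Local Notation meet := (@meet R X pos).

(** Along an increasing sequence the norm of a difference is the difference of
    the norms, so a bounded one is a Cauchy sequence. *)
Lemma cone_monotone_limit (a : nat -> X) y :
  (forall n, P (a n)) -> (forall n, P (a n.+1 - a n)) ->
  (forall n, P (y - a n)) ->
  exists l, [/\ forall n, P (l - a n), P (y - l) &
    forall e : R, 0 < e -> exists N, forall n, (N <= n)%N -> `|a n - l| <= e].
Proof.
move=> Pa aS ay.
have amono n k : P (a (n + k)%N - a n).
  elim: k => [|k IHk]; first by rewrite addn0 subrr.
  by rewrite addnS; exact: (cone_trans hP IHk (aS _)).
have anorm n k : `|a (n + k)%N - a n| = `|a (n + k)%N| - `|a n|.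
  rewrite -[a (n + k)%N in RHS](subrK (a n)).
  by rewrite (cone_norm hP (amono n k) (Pa n)) addrK.
have ncvg : cvgn (fun n => `|a n|).
  apply: nondecreasing_is_cvgn.
    by apply/nondecreasing_seqP => n; exact: (cone_norm_le hP).
  by exists `|y| => _ [n _ <-]; exact: (cone_norm_le hP).
set L := limn (fun n => `|a n|).
have nle n : `|a n| <= L.
  apply: nondecreasing_cvgn_le => //.
  by apply/nondecreasing_seqP => k; exact: (cone_norm_le hP).
have near_ e : 0 < e -> exists N, L - e < `|a N|.
  move=> e0; have /cvgrPdist_lt/(_ e e0)[N _ /(_ N (leqnn N))] := ncvg.
  rewrite /= -/L => NL; exists N; move: NL; rewrite ltr_norml => /andP[]; lra.
have acauchy e : 0 < e -> exists N, forall k, `|a (N + k)%N - a N| < e.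
  move=> e0; have [N NL] := near_ e e0; exists N => k.
  by rewrite anorm; have := nle (N + k)%N; lra.
have acvg : cvgn a.
  apply: cauchy_cvg; apply: cauchy_exP => e e0.
  have [N Ne] := acauchy e e0; exists (a N); exists N => // n /= Nn.
  by rewrite -ball_normE/= distrC -(subnKC Nn).
set l := limn a.
have al e : 0 < e -> exists N, forall k, `|a (N + k)%N - l| <= e.
  move=> e0; have /cvgrPdist_le/(_ e e0)[N _ Nl] := acvg.
  by exists N => k; rewrite distrC; apply: Nl; rewrite /= leq_addr.
exists l; split.
- move=> n; apply: (cone_closed hP) => e e0; have [N Ne] := al e e0.
  exists (a (N + n)%N - a n); first by rewrite addnC.
  have -> : a (N + n)%N - a n - (l - a n) = a (N + n)%N - l by vec.
  exact: Ne.
- apply: (cone_closed hP) => e e0; have [N Ne] := al e e0.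
  exists (y - a (N + 0)%N) => //.
  have -> : y - a (N + 0)%N - (y - l) = - (a (N + 0)%N - l) by vec.
  by rewrite normrN.
- move=> e e0; have [N Ne] := al e e0; exists N => n Nn.
  by rewrite -(subnKC Nn).
Qed.

Context (h : dual X) (tau : R) (tau0 : 0 <= tau)
  (h_le : forall x, h x <= tau * `|x|).

(** On the cone the defect is additive and non-negative; it vanishes where $h$
    attains the bound $\tau$. *)
Definition defect x := tau * `|x| - h x.

Lemma defect_ge0 x : 0 <= defect x.
Proof. by rewrite subr_ge0. Qed.

Lemma defectD x y : P x -> P y -> defect (x + y) = defect x + defect y.
Proof.
by move=> Px Py; rewrite /defect (cone_norm hP)// dual_linearE; ring.
Qed.

Lemma defectZ c x : 0 <= c -> defect (c *: x) = c * defect x.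
Proof.
by move=> c0; rewrite /defect normrZ ger0_norm// dual_linearE; ring.
Qed.

Lemma defect_le a b : P a -> P (b - a) -> defect a <= defect b.
Proof.
by move=> Pa ba; rewrite -[b](subrK a) defectD// lerDr defect_ge0.
Qed.

Lemma defect_limit l e :
  (forall d, 0 < d -> exists2 x, `|x - l| <= d & defect x <= e) ->
  defect l <= e.
Proof.
move=> near; apply/ler_addgt0Pr => d d0.
have M0 : 0 < tau + `|h| + 1 by rewrite ltr_wpDl// addr_ge0.
have [|x xl xe] := near (d / (tau + `|h| + 1)); first by rewrite divr_gt0.
have nx : `|l| <= `|x| + `|x - l|.
  by rewrite -[in leLHS](subKr x l) (le_trans (ler_normB _ _)).
have hx : h x - h l <= `|h| * `|x - l|.
  by rewrite (le_trans (ler_norm _))// -linearB; exact: bl_norm_le.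
have : (tau + `|h|) * `|x - l| <= d.
  have := ler_wpM2l (ltW M0) xl; rewrite mulrCA mulfV ?gt_eqF// mulr1.
  by have := normr_ge0 (x - l); lra.
have := ler_wpM2l tau0 nx; rewrite mulrDr; move: xe hx; rewrite /defect.
lra.
Qed.

(** Otherwise there are overlaps $u_n = y \wedge v_n$ of norm above
    $\varepsilon$ and defect at most $2^{-n}$. The defect of a supremum is at
    most the sum of the defects, so $\sup_{m \ge n} u_m$, which exists below
    $y$, has defect at most $2^{1 - n}$, and these suprema decrease with $n$ to
    a non-zero vector of defect zero. *)
Lemma small_overlap y : P y ->
  (forall x, P x -> x != 0 -> defect x != 0) ->
  forall e : R, 0 < e -> exists2 d : R, 0 < d &
    forall v, P v -> `|v| = 1 -> defect v < d -> `|meet y v| <= e.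
Proof.
move=> Py nodef e e0; apply: contrapT => nd.
have /choice[u uP] : forall n, exists u,
    [/\ P u, P (y - u), e < `|u| & defect u <= 2^-1 ^+ n].
  move=> n; apply: contrapT => nu; apply: nd; exists (2^-1 ^+ n).
    by rewrite exprn_gt0.
  move=> v Pv v1 vd; rewrite leNgt; apply/negP => ev; apply: nu.
  have Pm : P (meet y v) by exact: (meet_ge0 hP).
  exists (meet y v); split=> //; first exact: (meet_lel hP).
  by apply: le_trans (ltW vd); apply: defect_le => //; exact: (meet_ler hP).
pose join a b := b + pos (a - b).
have join_ge a b : P b -> P (join a b).
  by move=> Pb; apply: addP => //; exact: pos_cone hP _.
have joinl a b : P (join a b - a).
  by apply: (cone_cast (P := P) (pos_ge hP (a - b))); rewrite /join; vec.
have joinr a b : P (join a b - b).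
  by apply: (cone_cast (P := P) (pos_cone hP (a - b))); rewrite /join; vec.
have join_least a b z : P (z - a) -> P (z - b) -> P (z - join a b).
  move=> za zb; have zab : P (z - b - (a - b)).
    by apply: (cone_cast (P := P) za); vec.
  by apply: (cone_cast (P := P) (pos_least hP zb zab)); rewrite /join; vec.
have join_defect a b : P a -> P b -> defect (join a b) <= defect a + defect b.
  move=> Pa Pb; rewrite -defectD//.
  have -> : a + b = join a b + meet a b by rewrite /join /meet; vec.
  rewrite (@defectD (join a b) (meet a b)) ?lerDl ?defect_ge0//.
    exact: join_ge.
  exact: (meet_ge0 hP).
(* w n k is the supremum of u n, ..., u (n + k). *)
pose fix w n k := if k is k'.+1 then join (w n k') (u (n + k)%N) else u n.
have w0 n : w n 0 = u n by [].
have wE n k : w n k.+1 = join (w n k) (u (n + k.+1)%N) by [].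
have Pw n k : P (w n k).
  case: k => [|k]; first by rewrite w0; have [] := uP n.
  by rewrite wE; apply: join_ge; have [] := uP (n + k.+1)%N.
have wy n k : P (y - w n k).
  elim: k => [|k IHk]; first by rewrite w0; have [] := uP n.
  by rewrite wE; apply: join_least => //; have [] := uP (n + k.+1)%N.
have wS n k : P (w n k.+1 - w n k) by rewrite wE; exact: joinl.
have wd n k : defect (w n k) <= 2^-1 ^+ n * (2 - 2^-1 ^+ k).
  elim: k => [|k IHk]; rewrite ?w0 ?wE.
    by have [_ _ _ /le_trans] := uP n; apply; rewrite expr0; lra.
  have [Pu _ _ ud] := uP (n + k.+1)%N.
  apply: (le_trans (join_defect _ _ (Pw n k) Pu)).
  apply: (le_trans (lerD IHk ud)); rewrite exprD exprS.
  set s := (2^-1 ^+ n : R); set t := (2^-1 ^+ k : R).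
  suff : s * (2 - t) + s * (2^-1 * t) = s * (2 - 2^-1 * t) by move->.
  by field.
have wn n k : P (w n k.+1 - w n.+1 k).
  elim: k => [|k IHk]; first by rewrite wE !w0 addn1; exact: joinr.
  rewrite [w n k.+2]wE [w n.+1 k.+1]wE.
  apply: join_least; last by rewrite addSnnS; exact: joinr.
  exact: (cone_trans hP IHk (joinl _ _)).
have /choice[W WP] : forall n, exists W, [/\ forall k, P (W - w n k), P (y - W) &
    forall d : R, 0 < d -> exists K, forall k, (K <= k)%N -> `|w n k - W| <= d].
  by move=> n; exact: cone_monotone_limit.
have WS n : P (W n - W n.+1).
  apply: (cone_closed hP) => d d0; have [_ _ /(_ d d0)[k /(_ k (leqnn k)) kd]] := WP n.+1.
  have [/(_ k.+1) Wk _ _] := WP n.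
  exists (W n - w n.+1 k); first exact: (cone_trans hP (wn n k) Wk).
  have -> : W n - w n.+1 k - (W n - W n.+1) = - (w n.+1 k - W n.+1) by vec.
  by rewrite normrN.
have WPos n : P (W n).
  have [/(_ 0%N) W0 _ _] := WP n; have := addP W0 (Pw n 0).
  by rewrite subrK.
have We n : e < `|W n|.
  have [/(_ 0%N) W0 _ _] := WP n; have [Pu _ eu _] := uP n.
  exact: lt_le_trans eu (cone_norm_le hP Pu W0).
have Wd n : defect (W n) <= 2^-1 ^+ n * 2.
  apply: defect_limit => d d0; have [_ _ /(_ d d0)[k /(_ k (leqnn k)) kd]] := WP n.
  exists (w n k) => //; apply: le_trans (wd n k) _.
  rewrite ler_wpM2l ?exprn_ge0// gerBl exprn_ge0//.
have [|||l [Wl ly lW]] := @cone_monotone_limit (fun n => y - W n) y.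
- by move=> n; have [] := WP n.
- by move=> n; apply: (cone_cast (P := P) (WS n)); vec.
- by move=> n; rewrite subKr.
have near_l d : 0 < d -> exists N, forall n, (N <= n)%N -> `|W n - (y - l)| <= d.
  move=> d0; have [N Nd] := lW d d0; exists N => n Nn.
  have -> : W n - (y - l) = - (y - W n - l) by vec.
  by rewrite normrN; exact: Nd.
have el : e <= `|y - l|.
  apply/ler_addgt0Pr => d d0; have [N /(_ N (leqnn N)) Nd] := near_l d d0.
  apply: le_trans (ltW (We N)) _; rewrite -[W N](subrK (y - l)) addrC.
  by apply: le_trans (ler_normD _ _) _; rewrite lerD2l.
have VN0 : y - l != 0 by rewrite -normr_gt0; exact: lt_le_trans el.
have := nodef _ ly VN0; apply/negP; rewrite negbK.
rewrite eq_le defect_ge0 andbT; apply/ler_addgt0Pr => r r0; rewrite add0r.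
apply: defect_limit => d d0; have [N Nd] := near_l d d0.
have [M Mr] : exists M, (2^-1 ^+ M * 2 : R) < r.
  have r2 : 0 < r / 2 by rewrite divr_gt0.
  have [M _ /(_ M (leqnn M)) /=] := near_infty_natSinv_expn_lt (PosNum r2).
  by rewrite div1r ltr_pdivlMr// => Mr; exists M; rewrite exprVn.
exists (W (N + M)%N); first by apply: Nd; exact: leq_addr.
apply: le_trans (Wd _) _; apply: le_trans (ltW Mr).
rewrite ler_wpM2r// exprD ler_piMl ?exprn_ge0//.
by apply: exprn_ile1; rewrite ?invr_ge0 ?invf_le1 ?ler1n.
Qed.
End Exhaustion.

(** * Atoms or copies of l1 *)

Section Dichotomy.
Context {R : realType} {X : completeNormedModType R} {P : X -> Prop}
  {pos : X -> X} (hP : L1_cone P pos).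

Let addP := cone_add hP.
Let scaleP := cone_scale hP.
Let P0 := cone0 hP.
Local Notation meet := (@meet R X pos).

(** The invariant holds the information on the partial sum $y$ of the vectors
    chosen so far that makes a further choice possible. *)
Lemma greedy_sequence (Inv : X -> Prop) (d : X -> R) : Inv 0 ->
  (forall y e, 0 < e -> Inv y -> exists v,
     [/\ P v, `|v| = 1, d v <= e, `|meet y v| <= e & Inv (y + v)]) ->
  exists v : nat -> X, forall n, [/\ P (v n), `|v n| = 1,
    d (v n) <= 2^-1 ^+ n / 8 &
    `|meet (\sum_(i < n) v i) (v n)| <= 2^-1 ^+ n / 8].
Proof.
move=> Inv0 step.
pose good (y : X) (n : nat) v := [/\ P v, `|v| = 1, d v <= 2^-1 ^+ n / 8,
  `|meet y v| <= 2^-1 ^+ n / 8 & Inv (y + v)].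
have /choice[f fP] : forall yn : X * nat, exists v,
    Inv yn.1 -> good yn.1 yn.2 v.
  move=> [y n] /=; have [Iy|nIy] := pselect (Inv y); last by exists 0.
  have [||v vP] := step y (2^-1 ^+ n / 8) => //.
  by exists v.
pose fix y n := if n is n'.+1 then y n' + f (y n', n') else 0.
have yI n : Inv (y n) by elim: n => [//|n /(fP (_, n))[]].
have yE n : y n = \sum_(i < n) f (y i, nat_of_ord i).
  by elim: n => [|n IHn]; rewrite ?big_ord0 ?big_ord_recr//= -IHn.
exists (fun n => f (y n, n)) => n; rewrite -yE.
by have [] := fP (y n, n) (yI n).
Qed.

Context (h : dual X) (tau : R) (tau0 : 0 <= tau)
  (h_le : forall x, h x <= tau * `|x|).
Local Notation defect := (defect h tau).

(** If a non-zero positive vector has defect zero then so have all positive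
    vectors below it, and without atoms these can be split for ever. If there
    is none, the overlaps with a fixed vector are negligible. *)
Lemma atom_or_l1_sequence :
  (forall e, 0 < e -> exists v, [/\ P v, `|v| = 1 & defect v < e]) ->
  (exists2 e, atom P e & h e = tau) \/
  exists v : nat -> X, [/\ forall n, `|v n| = 1,
    forall n, tau - h (v n) <= 2^-1 ^+ n / 8 &
    forall b : nat -> R, (forall i, `|b i| <= 1) ->
      exists g : dual X, forall i, g (v i) = b i].
Proof.
move=> approx; have [|noatom] := pselect (exists2 e, atom P e & h e = tau).
  by left.
right; suff [v vP] : exists v : nat -> X, forall n, [/\ P (v n), `|v n| = 1,
    defect (v n) <= 2^-1 ^+ n / 8 &
    `|meet (\sum_(i < n) v i) (v n)| <= 2^-1 ^+ n / 8].
  exists v; split.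
  - by move=> n; have [] := vP n.
  - by move=> n; have [_ v1 + _] := vP n; rewrite /defect v1 mulr1.
  - move=> b b1; apply: (almost_disjoint_interpolation hP) => // n.
    + by have [] := vP n.
    + by have [] := vP n.
    + by have [] := vP n.
have [[x [Px x0 dx]]|nox] := pselect (exists x, [/\ P x, x != 0 & defect x = 0]).
  (* b is a reserve, disjoint from y, that is split once more at each step. *)
  apply: (@greedy_sequence (fun y => P y /\ exists b,
    [/\ P b, b != 0, defect b = 0 & meet y b = 0])).
    split=> //; exists x; split=> //; apply: (cone_eq0 hP).
      exact: (meet_ge0 hP).
    by have := meet_lel hP 0 x; rewrite sub0r.
  move=> y eps eps0 [Py [b [Pb b0 db yb]]].
  have nb0 : `|b| != 0 by rewrite normr_eq0.
  have bi : 0 <= `|b|^-1 by rewrite invr_ge0.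
  set e := `|b|^-1 *: b.
  have Pe : P e by exact: scaleP.
  have e1 : `|e| = 1 by rewrite normrZ ger0_norm// mulVf.
  have de : defect e = 0 by rewrite defectZ// db mulr0.
  have [|a [c [[Pa Pc a0 c0 ac] [ea [k k0 kc]]]]] := split_of_not_atom hP Pe e1.
    move=> ae; apply: noatom; exists e => //.
    by move: de; rewrite /defect e1 mulr1; lra.
  have below z k' : P z -> 0 <= k' -> P (k' *: e - z) -> defect z = 0.
    move=> Pz k'0 ez; apply/eqP; rewrite eq_le defect_ge0// andbT.
    by apply: le_trans (defect_le hP h_le Pz ez) _; rewrite defectZ// de mulr0.
  have ai : 0 <= `|a|^-1 by rewrite invr_ge0.
  have under z k' : P z -> 0 <= k' -> P (k' *: e - z) -> meet y z = 0.
    move=> Pz k'0 ez.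
    apply: (@meet0_under _ _ _ _ hP (k' * `|b|^-1) y b) => //.
      exact: mulr_ge0.
    by rewrite -scalerA.
  have ea1 : P (1 *: e - a) by rewrite scale1r.
  exists (`|a|^-1 *: a); split.
  - exact: scaleP.
  - by rewrite normrZ ger0_norm// mulVf// normr_eq0.
  - by rewrite defectZ// (below _ _ Pa ler01 ea1) mulr0 ltW.
  - rewrite (meetC hP) (meet0_scale hP)// ?normr0 ?ltW//.
    by rewrite (meetC hP); exact: (under _ _ Pa ler01 ea1).
  - split; first by apply: addP => //; exact: scaleP.
    exists c; split=> //; first exact: (below _ k).
    apply: (meet0D hP) => //; first exact: scaleP.
      exact: (under _ k).
    exact: (meet0_scale hP).
apply: (@greedy_sequence P) => // y e e0 Py.
have [|d d0 dP] := @small_overlap _ _ _ _ hP h tau tau0 h_le y Py _ e e0.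
  by move=> x Px x0; apply/eqP => dx; apply: nox; exists x.
have [|v [Pv v1 vd]] := approx (Num.min d e); first by rewrite lt_min d0.
move: vd; rewrite lt_min => /andP[vd ve].
by exists v; split=> //; [exact: ltW | exact: dP | exact: addP].
Qed.

End Dichotomy.

(** Replacing $h$ by $-h$ if necessary, the norm of $h$ is approached on the
    cone. *)
Lemma signed_atom_or_l1_sequence {R : realType} {X : completeNormedModType R}
    {P : X -> Prop} {pos : X -> X} (hP : L1_cone P pos) (h : dual X) (tau : R) :
  0 < tau -> (forall x, `|h x| <= tau * `|x|) ->
  (forall e, 0 < e -> exists2 x, `|x| <= 1 & tau - e < h x) ->
  exists2 s : R, `|s| = 1 &
  (exists2 e, atom P e & s * h e = tau) \/
  exists v : nat -> X, [/\ forall n, `|v n| = 1,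
    forall n, tau - s * h (v n) <= 2^-1 ^+ n / 8 &
    forall b : nat -> R, (forall i, `|b i| <= 1) ->
      exists g : dual X, forall i, g (v i) = b i].
Proof.
move=> tau0 htau approx.
pose good (s : R) := forall e, 0 < e ->
  exists v, [/\ P v, `|v| = 1 & defect (s *: h) tau v < e].
have hs s x : (s *: h) x = s * h x by [].
suff [s s1 sP] : exists2 s : R, `|s| = 1 & good s.
  have sle x : (s *: h) x <= tau * `|x|.
    by rewrite hs; apply: le_trans (ler_norm _) _; rewrite normrM s1 mul1r.
  exists s => //; have [|] := atom_or_l1_sequence hP (ltW tau0) sle sP.
  - by left.
  - by right.
apply: contrapT => ngood.
have bad s : `|s| = 1 -> exists2 e, 0 < e &
    forall v, P v -> s * h v <= (tau - e) * `|v|.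
  move=> s1; apply: contrapT => nbad; apply: ngood; exists s => // e e0.
  apply: contrapT => nv; apply: nbad; exists e => // v Pv.
  have [->|v0] := eqVneq v 0; first by rewrite dual_linearE normr0 !mulr0.
  have nv0 : 0 < `|v| by rewrite normr_gt0.
  rewrite leNgt; apply/negP => hv; apply: nv; exists (`|v|^-1 *: v).
  have n1 : `|(`|v|^-1 *: v)| = 1.
    by rewrite normrZ ger0_norm ?invr_ge0// mulVf ?gt_eqF.
  split=> //; first by apply: (cone_scale hP); rewrite ?invr_ge0.
  rewrite /defect n1 mulr1 hs dual_linearE mulrCA.
  have : tau - e < `|v|^-1 * (s * h v) by rewrite ltr_pdivlMl// mulrC.
  lra.
have [e e0 eP] := bad 1 (normr1 _).
have [|d d0 dP] := bad (-1); first by rewrite normrN normr1.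
pose m := Num.min (Num.min d e) tau.
have m0 : 0 < m by rewrite !lt_min d0 e0 tau0.
have [x x1] := approx m m0.
have := eP _ (pos_cone hP x); have := dP _ (pos_ge hP x).
have -> : h x = h (pos x) - h (pos x - x) by rewrite !dual_linearE; ring.
have [me md mt] : [/\ m <= e, m <= d & m <= tau].
  by rewrite /m !ge_min !lexx ?orbT.
have := pos_norm hP x; rewrite mul1r mulN1r.
set a := `|pos x|; set b := `|pos x - x| => nx.
have a0 : 0 <= a by exact: normr_ge0.
have b0 : 0 <= b by exact: normr_ge0.
move=> hb ha hx.
have : (tau - m) * (a + b) <= tau - m.
  by rewrite ler_piMr ?subr_ge0// -nx.
have : (tau - e) * a <= (tau - m) * a by rewrite ler_wpM2r// lerD2l lerN2.
have : (tau - d) * b <= (tau - m) * b by rewrite ler_wpM2r// lerD2l lerN2.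
lra.
Qed.

(** * Functionals that support a multi-smooth operator *)

(** In an $n$-dimensional span, a biorthogonal system of $n + 1$ functionals
    would factor the identity matrix of order $n + 1$ through rank $n$. *)
Lemma finite_dimensional_biorthogonal {R : realType} {W : normedModType R}
    (J : set (dual W)) : finite_dimensional (linear_span J) ->
  exists n, forall (F : 'I_n.+1 -> dual W) (S : 'I_n.+1 -> W),
    (forall j, J (F j)) -> (forall j k, F j (S k) = (j == k)%:R) -> False.
Proof.
move=> [n [e Je]]; exists n => F S JF FS.
have /choice[C CE] : forall j, exists c : 'I_n -> R, F j = \sum_i c i *: e i.
  move=> j; have : linear_span J (F j).
    by exists 1%N, (fun=> 1), (fun=> F j); split=> //; rewrite big_ord1 scale1r.
  rewrite Je => -[m [c [x [xe ->]]]].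
  have /choice[s sE] : forall i, exists k, e k = x i.
    by move=> i; have [k _] := xe i; exists k.
  exists (fun k => \sum_(i < m | s i == k) c i).
  rewrite (partition_big s predT)//=; apply: eq_bigr => k _.
  by rewrite scaler_suml; apply: eq_bigr => i /eqP <-; rewrite sE.
pose A := \matrix_(j < n.+1, i < n) C j i.
pose B := \matrix_(i < n, k < n.+1) (e i (S k) : R).
have evalE (I : finType) (G : I -> dual W) x :
    (\sum_i G i) x = \sum_i (G i x : R).
  have : forall r, (\sum_(i <- r) G i) x = \sum_(i <- r) (G i x : R).
    elim=> [|i r IHr]; first by rewrite !big_nil.
    by rewrite !big_cons -IHr.
  by apply.
have AB : A *m B = 1%:M.
  apply/matrixP => j k; rewrite !mxE -FS CE evalE.
  by apply: eq_bigr => i _; rewrite !mxE.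
have := mulmx_max_rank A B; rewrite AB mxrank1.
by rewrite ltnn.
Qed.

Section LimitFunctionals.
Context {R : realType} {X Y : normedModType R}.

(** A linear functional below $S \mapsto \limsup_i f (S x_i)$ is a generalized
    limit of $f (S x_i)$: it takes the value of the limit where there is one. *)
Lemma limit_functional (x : nat -> X) (f : dual Y) :
  (forall i, `|x i| <= 1) -> `|f| <= 1 ->
  exists2 F : dual (BL X Y), `|F| <= 1 & forall (S : BL X Y) c,
    (forall e : R, 0 < e -> exists N, forall i, (N <= i)%N ->
       `|f (S (x i)) - c| <= e) -> F S = c.
Proof.
move=> x1 f1.
have fS (S : BL X Y) i : `|f (S (x i))| <= `|S|.
  apply: le_trans (bl_le _ f1) _; rewrite mul1r.
  by apply: le_trans (bl_norm_le S _) _; rewrite ler_piMr.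
pose Q (S : BL X Y) := [set r : R | exists N, forall i, (N <= i)%N ->
  f (S (x i)) <= r].
have Qnorm S : Q S `|S|.
  by exists 0%N => i _; exact: le_trans (ler_norm _) (fS S i).
have Qinf S : has_inf (Q S).
  split; first by exists `|S|.
  exists (- `|S|) => r [N /(_ N (leqnn N))]; apply: le_trans.
  by have := fS S N; rewrite ler_norml => /andP[].
have sub : sublinear (fun S => inf (Q S)).
  apply: sublinear_inf => //.
    move=> S U r s [N Nr] [M Ms]; exists (r + s) => //; exists (maxn N M) => i.
    by rewrite geq_max blD dual_linearE => /andP[/Nr ? /Ms ?]; exact: lerD.
  move=> a S r a0 [N Nr]; exists (a * r) => //; exists N => i /Nr.
  by rewrite blZ dual_linearE => ?; exact: ler_wpM2l.
have [G GQ] := hahn_banach sub.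
have GS S : G S <= `|S|.
  by apply: le_trans (GQ S) _; exact: (ge_inf (proj2 (Qinf S))).
have GM S : `|G S| <= 1 * `|S|.
  rewrite mul1r ler_norml GS andbT lerNl -[- G S]linearN.
  by apply: le_trans (GS _) _; rewrite normrN.
have Gb : (G : BL X Y -> R^o) \in bounded_linear (BL X Y) R^o.
  apply/bounded_linearP; split; last by exists 1.
  by move=> a S U; rewrite linearP.
exists (MkBL Gb); first exact: bl_norm_le_bound.
have Gle (S : BL X Y) (c : R) : (forall e : R, 0 < e -> exists N, forall i, (N <= i)%N ->
    `|f (S (x i)) - c| <= e) -> G S <= c.
  move=> Sc; apply: le_trans (GQ S) _; apply/ler_addgt0Pr => e e0.
  apply: (ge_inf (proj2 (Qinf S))); have [N Ne] := Sc e e0.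
  by exists N => i /Ne; rewrite ler_norml => /andP[]; lra.
move=> S c Sc /=; apply/eqP; rewrite eq_le Gle//= -lerN2 -[- G S]linearN.
apply: Gle => e /Sc[N Ne]; exists N => i /Ne.
by rewrite dual_linearE -opprD normrN.
Qed.

Lemma rank_one_subproof (g : dual X) (y : Y) :
  (fun x => (g x : R) *: y) \in bounded_linear X Y.
Proof.
apply/bounded_linearP; split.
  by move=> a u v; rewrite dual_linearE dual_linearE scalerDl scalerA.
exists (`|g| * `|y|) => x; rewrite normrZ mulrAC ler_wpM2r//.
exact: bl_norm_le.
Qed.

Definition rank_one g y : BL X Y := MkBL (rank_one_subproof g y).

(** The generalized limits of $S \mapsto f_j (S x_{j i})$ as $i \to \infty$ lie
    in $J (T)$, and the rank-one operators $g_k \otimes y_k$ with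
    $f_k (y_k) = 1$ show that they are linearly independent. *)
Lemma multi_smooth_no_biorthogonal (T : BL X Y) : multi_smooth_finite_order T ->
  exists n, forall (x : 'I_n.+1 -> nat -> X) (f : 'I_n.+1 -> dual Y)
      (g : 'I_n.+1 -> dual X),
    (forall j i, `|x j i| <= 1) -> (forall j, `|f j| <= 1) ->
    (forall j (e : R), 0 < e -> exists N, forall i, (N <= i)%N ->
       `|f j (T (x j i)) - `|T| | <= e) ->
    (forall k j i, g k (x j i) = (j == k)%:R) -> False.
Proof.
move=> [T0 /finite_dimensional_biorthogonal[n nP]]; exists n.
move=> x f g x1 f1 fT gx.
have nT : 0 < `|T| by rewrite normr_gt0; exact/eqP.
have /choice[F FP] : forall j, exists F : dual (BL X Y), `|F| <= 1 /\
    forall (S : BL X Y) c, (forall e : R, 0 < e -> exists N, forall i,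
      (N <= i)%N -> `|f j (S (x j i)) - c| <= e) -> F S = c.
  by move=> j; have [F F1 FP] := limit_functional (x1 j) (f1 j); exists F.
have FT j : F j T = `|T| by have [_] := FP j; apply; exact: fT.
have /choice[y yP] : forall k, exists y, f k y = 1.
  move=> k; have nT2 : 0 < `|T| / 2 by rewrite divr_gt0.
  have [N /(_ N (leqnn N))] := fT k _ nT2.
  rewrite ler_norml => /andP[fN _]; have {}fN : f k (T (x k N)) != 0.
    by rewrite gt_eqF//; move: fN; rewrite lerBrDr; lra.
  exists ((f k (T (x k N)) : R)^-1 *: T (x k N)).
  by rewrite dual_linearE mulVf.
apply: (nP F (fun k => rank_one (g k) (y k))).
  move=> j; split; last exact: FT.
  rewrite /unit_sphere/=; apply/eqP; rewrite eq_le (FP j).1/=.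
  have := bl_norm_le (F j) T; rewrite FT ger0_norm//.
  by rewrite -[leLHS]mul1r ler_pM2r.
move=> j k; apply: (FP j).2 => e e0; exists 0%N => i _ /=.
rewrite gx dual_linearE; have [->|jk] := eqVneq j k.
  by rewrite yP mul1r subrr normr0 ltW.
by rewrite mul0r subr0 normr0 ltW.
Qed.

End LimitFunctionals.

(** * Compact operators and systems of atoms *)

Lemma bl_sum {R : realType} {X Y : normedModType R} (f : BL X Y) n
    (F : 'I_n -> X) : f (\sum_(i < n) F i) = \sum_(i < n) f (F i).
Proof.
elim: n F => [|n IHn] F; first by rewrite !big_ord0 linear0.
by rewrite !big_ord_recr/= linearD/= IHn.
Qed.

Section AtomSystems.
Context {R : realType} {X Y : completeNormedModType R}.

(** The norm of a compact operator is attained on the closure of the image of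
    the ball, so one functional on $Y$ suffices to approach it. *)
Lemma compact_norming (S : BL X Y) : compact_op S ->
  exists2 f : dual Y, `|f| <= 1 & forall e : R, 0 < e ->
    exists2 x, `|x| <= 1 & `|S| - e < f (S x).
Proof.
rewrite /compact_op precompactE.
set K := closure _ => Kcompact.
have SK x : `|x| <= 1 -> K (S x).
  by move=> x1; apply: subset_closure; exists x.
have [||y /set_mem Ky ymax] := @compact_EVT_max _ R (fun y : Y => `|y|) K _ Kcompact.
- by exists (S 0); apply: SK; rewrite normr0.
- by apply: continuous_subspaceT; exact: norm_continuous.
have [f f1 fy] := norming_functional y; exists f => // e e0.
have e2 : 0 < e / 2 by rewrite divr_gt0.
have [z [[x x1 <-] xy]] := Ky _ (nbhsx_ballx y (e / 2) e2).
exists x => //; have Sy : `|S| <= `|y|.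
  by apply: opnorm_le => u u1; apply: ymax; rewrite inE; exact: SK.
have : `|f (S x - y)| <= 1 * `|S x - y| by exact: bl_le.
rewrite linearB /= ler_norml => /andP[].
move: xy; rewrite -ball_normE/= distrC fy; lra.
Qed.

(** The composition of $T$ with $x \mapsto x - \sum_i \varphi_i (x) e_i$. *)
Definition compression (T : BL X Y) m (e : nat -> X) (phi : nat -> dual X) :
  BL X Y := T - \sum_(i < m) rank_one (phi i) (T (e i)).

Lemma compressionE T m e phi x :
  compression T m e phi x = T (x - \sum_(i < m) (phi i x : R) *: e i).
Proof.
have sumE : (\sum_(i < m) rank_one (phi i) (T (e i))) x =
    T (\sum_(i < m) (phi i x : R) *: e i).
  rewrite bl_sum; elim: m => [|m IHm]; first by rewrite !big_ord0.
  by rewrite !big_ord_recr/= -IHm [in RHS]linearZ.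
by rewrite [RHS]linearB/= -sumE.
Qed.

(** $X$ is the $\ell^1$-sum of the lines through the $e_i$ and the common kernel
    of the $\varphi_i$, and $T$ attains its norm at each $e_i$. *)
Record atom_system (T : BL X Y) m (e : nat -> X) (phi : nat -> dual X) : Prop :=
  AtomSystem {
  system_projection : forall i, (i < m)%N -> L_projection (e i) (phi i) ;
  system_dual : forall i j, (i < m)%N -> (j < m)%N ->
    phi i (e j) = (i == j)%:R ;
  system_split : forall x, `|x| = \sum_(i < m) `|phi i x : R| +
    `|x - \sum_(i < m) (phi i x : R) *: e i| ;
  system_attain : forall i, (i < m)%N -> `|T (e i)| = `|T| }.

Lemma compression_norm T m e phi x : atom_system T m e phi ->
  `|compression T m e phi x| <=
    `|T| * (`|x| - \sum_(i < m) `|phi i x : R|).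
Proof.
move=> sys; rewrite compressionE; apply: le_trans (bl_norm_le T _) _.
by rewrite (system_split sys x) [_ + `|_|]addrC addrK.
Qed.

Lemma compression_norm_le T m e phi x : atom_system T m e phi ->
  `|compression T m e phi x| <= `|T| * `|x|.
Proof.
move=> sys; apply: le_trans (compression_norm x sys) _.
by rewrite ler_wpM2l// gerBl sumr_ge0.
Qed.

Lemma compression_compact T m e phi : atom_system T m e phi ->
  compact_op T -> compact_op (compression T m e phi).
Proof.
move=> sys; apply: precompact_subset => _ [x x1 <-].
exists (x - \sum_(i < m) (phi i x : R) *: e i); last by rewrite compressionE.
have := system_split sys x; rewrite /unit_ball/= => xE.
apply: le_trans x1; rewrite [leRHS]xE lerDr; exact: sumr_ge0.
Qed.

(** If the compression has full norm at $a$, the coordinates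
    $\varphi_i (a)$ leave no room and vanish; conversely $\psi (e_i) = 0$
    because $e_i - \psi (e_i) a$ has $i$-th coordinate $1$. *)
Lemma atom_system_extend (T : BL X Y) m e phi a psi : atom_system T m e phi ->
  L_projection a psi -> `|compression T m e phi a| = `|T| -> T != 0 ->
  atom_system T m.+1 (fun i => if i == m then a else e i)
                     (fun i => if i == m then psi else phi i).
Proof.
move=> sys aproj Ta T0; have [a1 pa asplit] := aproj.
have nT : 0 < `|T| by rewrite normr_gt0.
have phia i : (i < m)%N -> phi i a = 0.
  move=> im; have := compression_norm a sys; rewrite Ta a1.
  rewrite -[leLHS]mulr1 ler_pM2l// lerBrDr gerDl => s0.
  apply/eqP; rewrite -normr_le0; apply: le_trans s0.
  by rewrite (bigD1 (Ordinal im))//= lerDl sumr_ge0.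
have psie i : (i < m)%N -> psi (e i) = 0.
  move=> im; have := asplit (e i); have [-> _ _] := system_projection sys im.
  set x := e i - _; have : 1 <= `|x|.
    rewrite (system_split sys x) (bigD1 (Ordinal im))//= -addrA.
    rewrite /x dual_linearE dual_linearE dual_linearE phia// mulr0 subr0.
    by rewrite (system_dual sys)// eqxx normr1 lerDl addr_ge0// sumr_ge0.
  move=> x1 e1; apply/eqP; rewrite -normr_le0; lra.
have neq (i : 'I_m) : (nat_of_ord i == m) = false.
  by rewrite ltn_eqF.
have sumE (V : zmodType) (f : nat -> V) (v : V) :
    \sum_(i < m.+1) (if nat_of_ord i == m then v else f i) =
    \sum_(i < m) f i + v.
  rewrite big_ord_recr/= eqxx; congr (_ + _).
  by apply: eq_bigr => i _; rewrite neq.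
have lt i : (i < m.+1)%N -> i != m -> (i < m)%N.
  by move=> im iN; rewrite ltn_neqAle iN -ltnS.
split.
- by move=> i im; case: eqVneq => // /(lt _ im); exact: (system_projection sys).
- move=> i j im jm; case: (eqVneq i m) => [->|/(lt _ im) im'].
    by case: (eqVneq j m) => [_|/(lt _ jm)/psie].
  case: (eqVneq j m) => [->|/(lt _ jm) jm']; last exact: (system_dual sys).
  by rewrite phia// ltn_eqF.
- move=> x; rewrite !big_ord_recr/= eqxx.
  under eq_bigr do rewrite neq; under [X in `|x - (X + _)|]eq_bigr do rewrite neq.
  rewrite (system_split sys x) -addrA; congr (_ + _).
  set z := x - \sum_(i < m) (phi i x : R) *: e i; rewrite (asplit z).
  have -> : psi z = psi x.
    rewrite /z 2!dual_linearE bl_sum big1 ?subr0// => i _.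
    by rewrite dual_linearE psie// mulr0.
  by rewrite /z opprD addrA.
- move=> i im; case: eqVneq => [_|/(lt _ im)]; last exact: (system_attain sys).
  move: Ta; rewrite compressionE big1 ?subr0// => k _.
  by rewrite phia// scale0r.
Qed.

End AtomSystems.

(** * Orthogonality at an atom, and the bidual *)

(** Atoms at which $T$ attains its norm are collected one after the other. As
    long as the compression of $T$ to their complement has full norm, a
    functional $h = f \circ S$ of the same norm, where $S$ is the compression,
    yields a further atom: an almost disjoint sequence $v$ along which $h$
    approaches its norm would produce too many functionals in $J (T)$, one for
    each residue class of indices modulo a large number. For the same reason there are only finitely
    many atoms. *)
Lemma complete_atom_system {R : realType} {X Y : completeNormedModType R}
    {P : X -> Prop} {pos : X -> X} (hP : L1_cone P pos) (T : BL X Y) :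
  compact_op T -> multi_smooth_finite_order T ->
  exists m e phi, atom_system T m e phi /\ `|compression T m e phi| < `|T|.
Proof.
move=> Tc Tm; have [n nP] := multi_smooth_no_biorthogonal Tm.
have T0 : T != 0 by apply/eqP; exact: Tm.1.
have nT : 0 < `|T| by rewrite normr_gt0.
suff H m : (exists k e phi, atom_system T k e phi /\
      `|compression T k e phi| < `|T|) \/ exists e phi, atom_system T m e phi.
  have [//|[e [phi sys]]] := H n.+1; exfalso.
  have /choice[f fP] : forall j : 'I_n.+1, exists f : dual Y,
      `|f| <= 1 /\ f (T (e j)) = `|T (e j)|.
    by move=> j; have [f f1 fe] := norming_functional (T (e j)); exists f.
  apply: (nP (fun j _ => e j) f (fun k => phi k)) => [j _|j|j r r0|k j _].
  - by have [-> _ _] := system_projection sys (ltn_ord j).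
  - exact: (fP j).1.
  - exists 0%N => i _; rewrite (fP j).2 (system_attain sys)//.
    by rewrite subrr normr0 ltW.
  - by rewrite (system_dual sys)// eq_sym.
elim: m => [|m [|[e [phi sys]]]].
- right; exists (fun=> 0), (fun=> 0); split=> // x.
  by rewrite !big_ord0 add0r subr0.
- by left.
have [lt|ge] := ltP `|compression T m e phi| `|T|.
  by left; exists m, e, phi.
set S := compression T m e phi in ge *.
have ST x : `|S x| <= `|T| * `|x| by exact: compression_norm_le.
have nS : `|S| = `|T|.
  by apply/eqP; rewrite eq_le ge andbT; exact: bl_norm_le_bound.
have [f f1 fS] := compact_norming (compression_compact sys Tc).
rewrite -/S nS in fS.
pose h := adjoint S f; have hE x : h x = f (S x) by [].
have hT x : `|h x| <= `|T| * `|x|.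
  by rewrite hE; apply: le_trans (bl_le _ f1) _; rewrite mul1r.
have [s s1 [[a Pa ha]|[v [v1 vh vg]]]] := signed_atom_or_l1_sequence hP nT hT fS.
  right; have [psi apsi] := atom_L_projection hP Pa.
  eexists; eexists; apply: (atom_system_extend sys apsi) => //.
  rewrite -/S; have [a1 _ _] := apsi; apply/eqP; rewrite eq_le.
  have := ST a; rewrite a1 mulr1 => -> /=; rewrite -ha.
  apply: le_trans (ler_norm _) _; rewrite normrM s1 mul1r hE.
  by apply: le_trans (bl_le _ f1) _; rewrite mul1r.
exfalso.
have sf x : `|s * f x| <= `|x|.
  rewrite normrM s1 mul1r; apply: le_trans (bl_le _ f1) _.
  by rewrite mul1r.
(* Nearly all of the mass of v i lies in the complement, where S = T. *)
have vT i : `|T (v i) - S (v i)| <= 2^-1 ^+ i / 8.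
  rewrite /S compressionE -linearB /= subKr.
  apply: le_trans (bl_norm_le T _) _.
  apply: (@le_trans _ _ (`|T| * \sum_(k < m) `|phi k (v i) : R|)).
    rewrite ler_wpM2l//; apply: le_trans (ler_norm_sum _ _ _) _.
    apply: ler_sum => k _; have [e1 _ _] := system_projection sys (ltn_ord k).
    by rewrite normrZ e1 mulr1.
  have := compression_norm (v i) sys; rewrite -/S v1 mulrBr mulr1.
  have := vh i; have := ler_norm (s * h (v i)); have := sf (S (v i)).
  rewrite hE; lra.
have near i : `|s * f (T (v i)) - `|T| | <= 2^-1 ^+ i.
  have := sf (T (v i) - S (v i)); rewrite linearB /= mulrBr.
  move=> /le_trans/(_ (vT i)); rewrite !ler_norml => /andP[].
  have := vh i; have := sf (S (v i)); have := ST (v i); rewrite hE v1 mulr1.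
  have := ler_norm (s * f (S (v i))).
  have : 0 <= (2^-1 : R) ^+ i by rewrite exprn_ge0.
  by move=> *; apply/andP; split; lra.
have /choice[g gP] : forall k : 'I_n.+1, exists g : dual X,
    forall i, g (v i) = (i %% n.+1 == k)%N%:R.
  move=> k; apply: (vg (fun i => (i %% n.+1 == k)%N%:R)) => i.
  by rewrite normr_nat lern1 leq_b1.
apply: (nP (fun j i => v (i * n.+1 + j)%N) (fun=> s *: f) g).
- by move=> j i; rewrite v1.
- by move=> _; rewrite normrZ s1 mul1r.
- move=> j r r0.
  have [N _ /(_ N (leqnn N)) /=] := near_infty_natSinv_expn_lt (PosNum r0).
  rewrite div1r -exprVn => Nr; exists N => i Ni.
  apply: le_trans (near _) _; apply: le_trans (ltW Nr).
  apply: ler_wiXn2l; rewrite ?invr_ge0 ?invf_le1 ?ler1n//.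
  by apply: leq_trans Ni _; rewrite mulnS -addnA leq_addr.
- by move=> k j i; rewrite gP modnMDl modn_small.
Qed.

Section Bidual.
Context {R : realType} {X : normedModType R}.

Lemma evaluation_subproof (x : X) :
  (fun g : dual X => g x : R^o) \in bounded_linear (dual X) R^o.
Proof.
apply/bounded_linearP; split; first by [].
by exists `|x| => g; rewrite mulrC; exact: bl_norm_le.
Qed.

Definition evaluation (x : X) : dual (dual X) := MkBL (evaluation_subproof x).

Lemma evaluation_norm x : `|evaluation x| = `|x|.
Proof.
apply/eqP; rewrite eq_le; apply/andP; split.
  apply: bl_norm_le_bound => // g; rewrite mulrC /=; exact: bl_norm_le.
have [f f1 <-] := norming_functional x.
apply: le_trans (ler_norm _) _.
apply: le_trans (bl_norm_le (evaluation x) f) _.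
by rewrite ler_piMr.
Qed.

(** For $g$ vanishing at $e$, the L-projection gives
    $\|k \varphi \pm g\| \le k$ with $k = \|g\|$. *)
Lemma L_projection_extreme (e : X) phi : L_projection e phi ->
  extreme_points (unit_ball (dual (dual X))) (evaluation e).
Proof.
move=> [e1 pe split_e]; split; first by rewrite /unit_ball/= evaluation_norm e1.
have phi1 : `|phi| <= 1.
  apply: bl_norm_le_bound => // x; rewrite mul1r (split_e x) lerDl//.
have unique (y : dual (dual X)) : `|y| <= 1 -> y phi = 1 -> y = evaluation e.
  move=> y1 yphi; apply/val_inj/funext => g /=.
  pose g' := g - (g e : R) *: phi; pose k := `|g'|.
  have bound (r : R) : `|r| = 1 -> `|k *: phi + r *: g'| <= k.
    move=> r1; apply: bl_norm_le_bound; first exact: normr_ge0.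
    move=> x; have -> : (k *: phi + r *: g') x = k * phi x + r * g' x by [].
    apply: le_trans (ler_normD _ _) _.
    rewrite !normrM r1 mul1r ger0_norm ?normr_ge0//.
    have -> : g' x = g' (x - (phi x : R) *: e).
      have ge' : g' e = 0.
        have -> : g' e = g e - g e * phi e by [].
        by rewrite pe mulr1 subrr.
      by rewrite !dual_linearE ge' mulr0 subr0.
    by rewrite (split_e x) mulrDr lerD2l; exact: bl_norm_le.
  have yb (r : R) : `|r| = 1 -> `|k + r * y g'| <= k.
    move=> r1; have := bl_le (k *: phi + r *: g') y1.
    by rewrite !dual_linearE yphi mulr1 mul1r => /le_trans; apply; exact: bound.
  have /eqP : y g' = 0.
    have := yb 1 (normr1 _); have := yb (-1); rewrite normrN normr1 => /(_ erefl).
    by rewrite !ler_norml => /andP[_ +] /andP[_ +]; lra.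
  by rewrite !dual_linearE yphi mulr1 subr_eq0 => /eqP.
move=> y z t y1 z1 /andP[t0 t1] eE.
have le1 (w : dual (dual X)) : `|w| <= 1 -> w phi <= 1.
  move=> w1; apply: le_trans (ler_norm _) _.
  by apply: le_trans (bl_le _ w1) _; rewrite mul1r.
have := le1 y y1; have := le1 z z1.
have : 1 = t * y phi + (1 - t) * z phi.
  by rewrite -[LHS]pe -[LHS]/(evaluation e phi) eE.
move=> yz zp yp.
have yphi : y phi = 1.
  by apply/eqP; rewrite eq_le yp/=; nra.
have zphi : z phi = 1 by apply/eqP; rewrite eq_le zp/=; nra.
by split; apply: unique.
Qed.

End Bidual.

Section Distances.
Context {R : realType}.

Lemma dist_to_le {V : normedModType R} (v : V) (W : set V) : W 0 ->
  dist_to v W <= `|v|.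
Proof.
move=> W0; rewrite -[v in leRHS]subr0; apply: ge_inf; last by exists 0.
by exists 0 => _ [w _ <-].
Qed.

Lemma dist_to_bj_orth {V : normedModType R} (v : V) (W : set V) : W 0 ->
  bj_orth_set v W -> dist_to v W = `|v|.
Proof.
move=> W0 vW; apply/eqP; rewrite eq_le dist_to_le//=; apply: lb_le_inf.
  by exists `|v - 0|, 0.
by move=> _ [w Ww <-]; rewrite -scaleN1r; exact: vW.
Qed.

Lemma sup_dist_to {X Y : normedModType R} (T : BL X Y) (W : set Y) x0 : W 0 ->
  norm_attaining T x0 -> bj_orth_set (T x0) W ->
  sup [set dist_to (T x) W | x in unit_sphere X] = dist_to (T x0) W.
Proof.
move=> W0 [x01 Tx0] x0W; rewrite dist_to_bj_orth// Tx0.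
have ub x : unit_sphere X x -> dist_to (T x) W <= `|T|.
  move=> x1; apply: le_trans (dist_to_le _ W0) _.
  by apply: le_trans (bl_norm_le T x) _; rewrite x1 mulr1.
apply/eqP; rewrite eq_le; apply/andP; split.
  apply: ge_sup; first by exists (dist_to (T x0) W), x0.
  by move=> _ [x x1 <-]; exact: ub.
apply: ub_le_sup; first by exists `|T| => _ [x x1 <-]; exact: ub.
by exists x0 => //; rewrite dist_to_bj_orth.
Qed.

Lemma adjoint_norm_le {X Y : normedModType R} (T : BL X Y) :
  `|adjoint T| <= `|T|.
Proof.
apply: bl_norm_le_bound => // f; apply: bl_norm_le_bound => [|x].
  exact: mulr_ge0.
rewrite /= [`|T| * _]mulrC -mulrA; apply: le_trans (bl_norm_le f _) _.
by rewrite ler_wpM2l// bl_norm_le.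
Qed.

End Distances.

(** If no $T e_i$ were orthogonal to $Z$, moving each $T e_i$ by some
    $z_i \in Z$ would shorten it, and the finite-rank operator
    $\sum_i \varphi_i \otimes z_i$ would bring $T$ closer to zero. *)
Lemma bj_orth_attained {R : realType} {X Y : completeNormedModType R}
    (T : BL X Y) (Z : set Y) m e phi : linear_subspace Z ->
  atom_system T m e phi -> `|compression T m e phi| < `|T| ->
  bj_orth_set T (ops_into X Z) ->
  exists2 i, (i < m)%N & bj_orth_set (T (e i)) Z.
Proof.
move=> [Z0 ZD] sys; set c := `|compression T m e phi| => cT TZ.
apply: contrapT => none.
have /choice[z zP] : forall i, exists z, (i < m)%N ->
    Z z /\ `|T (e i) + z| < `|T|.
  move=> i; have [im|] := boolP (i < m)%N; last by exists 0.
  apply: contrapT => nz; apply: none; exists i => // z Zz a.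
  rewrite (system_attain sys im) leNgt; apply/negP => lt.
  apply: nz; exists (a *: z) => _; split=> //.
  by rewrite -[a *: z]addr0; exact: ZD.
pose M := \big[Num.max/c]_(i < m) `|T (e i) + z i|.
have MT : M < `|T| by apply: bigmax_lt => // i _; have [] := zP i (ltn_ord i).
pose S : BL X Y := \sum_(i < m) rank_one (phi i) (z i).
have SE x : S x = \sum_(i < m) (phi i x : R) *: z i.
  rewrite /S; elim: (m) => [|k IHk]; first by rewrite !big_ord0.
  by rewrite !big_ord_recr/= -IHk.
have ZS : ops_into X Z S.
  move=> x; rewrite SE; elim/big_ind: _ => // [u v Zu Zv|i _].
    by have := ZD 1 _ _ Zu Zv; rewrite scale1r.
  by rewrite -[_ *: _]addr0; apply: ZD => //; have [] := zP i (ltn_ord i).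
have := TZ S ZS 1; rewrite scale1r leNgt => /negP; apply.
apply: le_lt_trans MT; apply: bl_norm_le_bound => [|x].
  by apply: le_trans (bigmax_ge_id _ _ _ _); exact: normr_ge0.
set q := x - \sum_(i < m) (phi i x : R) *: e i.
have phiq (k : 'I_m) : phi k q = 0.
  rewrite /q 2!dual_linearE bl_sum (bigD1 k)//= dual_linearE.
  rewrite (system_dual sys)// eqxx mulr1 big1 ?addr0 ?subrr// => i ik.
  rewrite dual_linearE (system_dual sys)//.
  by rewrite (_ : (k == i :> nat) = false) ?mulr0// eq_sym; exact/negbTE.
have Tq : `|T q| <= c * `|q|.
  have -> : T q = compression T m e phi q.
    rewrite compressionE big1 ?subr0// => k _; by rewrite phiq scale0r.
  exact: bl_norm_le.
have -> : (T + S) x = T q + \sum_(i < m) (phi i x : R) *: (T (e i) + z i).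
  have -> : (T + S) x = T x + S x by [].
  rewrite SE; have -> : T x = T q + \sum_(i < m) (phi i x : R) *: T (e i).
    rewrite -[x in LHS](subrK (\sum_(i < m) (phi i x : R) *: e i)) -/q.
    rewrite linearD/= bl_sum; congr (_ + _).
    by apply: eq_bigr => i _; rewrite linearZ.
  rewrite -addrA -big_split; congr (_ + _); apply: eq_bigr => i _.
  by rewrite scalerDr.
rewrite (system_split sys x) mulrDr addrC.
apply: le_trans (ler_normD _ _) _; apply: lerD.
  rewrite mulr_sumr; apply: le_trans (ler_norm_sum _ _ _) _.
  apply: ler_sum => i _; rewrite normrZ mulrC ler_wpM2r//.
  exact: (le_bigmax _ (fun i : 'I_m => `|T (e i) + z i|)).
apply: le_trans Tq _; rewrite ler_wpM2r//; exact: bigmax_ge_id.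
Qed.

(** The functional $f \in Z^\perp$ that attains the norm of $T a$ bounds all
    the norms below: each vector of $Z^{\perp\perp}$ vanishes at $f$, and
    $T^{**}$ maps the evaluation at $a$ to the evaluation at $T a$. *)
Theorem L1_cone_conclusion {R : realType} {X Y : completeNormedModType R}
    {P : X -> Prop} {pos : X -> X} (hP : L1_cone P pos)
    (Z : set Y) (T : BL X Y) : linear_subspace Z ->
  compact_op T -> multi_smooth_finite_order T ->
  bj_orth_set T (ops_into X Z) ->
  let X2 := dual (dual X) in
  let T2 := biadjoint T in
  let Z2 := annihilator (annihilator Z) in
  [/\ dist_to T (ops_into X Z)
        = sup [set dist_to (T x) Z | x in unit_sphere X],
      bj_orth_set T2 (ops_into X2 Z2) &
      exists2 x0 : X2,
        (norm_attaining T2 `&` extreme_points (unit_ball X2)) x0 &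
        bj_orth_set (T2 x0) Z2 /\
        [/\ dist_to T2 (ops_into X2 Z2)
              = sup [set dist_to (T2 x) Z2 | x in unit_sphere X2],
            sup [set dist_to (T2 x) Z2 | x in unit_sphere X2]
              = dist_to (T2 x0) Z2 &
            dist_to (T2 x0) Z2 = dist_to T (ops_into X Z)]].
Proof.
move=> hZ Tc Tm TZ X2 T2 Z2; have [Z0 _] := hZ.
have [m [e [phi [sys lt]]]] := complete_atom_system hP Tc Tm.
have [i im eZ] := bj_orth_attained hZ sys lt TZ.
have aproj := system_projection sys im; have [a1 _ _] := aproj.
have Ta := system_attain sys im; set a := e i in eZ aproj a1 Ta.
have [f f1 [fa fZ]] := bj_orth_functional hZ eZ.
pose x0 : X2 := evaluation a.
have T2f : T2 x0 f = `|T| by rewrite -Ta -fa.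
have x01 : `|x0| = 1 by rewrite evaluation_norm.
have T2le : `|T2| <= `|T|.
  by apply: le_trans (adjoint_norm_le _) _; exact: adjoint_norm_le.
have T2x0le w : Z2 w -> `|T| <= `|T2 x0 + w|.
  move=> Zw; rewrite -T2f; have <- : (T2 x0 + w) f = T2 x0 f.
    have -> : (T2 x0 + w) f = T2 x0 f + w f by [].
    by rewrite Zw// addr0.
  apply: le_trans (ler_norm _) _; apply: le_trans (bl_norm_le _ _) _.
  by rewrite ler_piMr.
have Z20 : Z2 0 by [].
have T2x0 : `|T2 x0| = `|T| /\ `|T2| = `|T|.
  have le1 := T2x0le 0 Z20; have := bl_norm_le T2 x0.
  by rewrite x01 mulr1; rewrite addr0 in le1; split; lra.
have x0Z : bj_orth_set (T2 x0) Z2.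
  move=> w Zw c; rewrite T2x0.1; apply: T2x0le => g Zg.
  have -> : (c *: w) g = c * w g by [].
  by rewrite Zw// mulr0.
have x0att : norm_attaining T2 x0 by split=> //; rewrite /= T2x0.1 T2x0.2.
have T2Z : bj_orth_set T2 (ops_into X2 Z2).
  move=> S SZ c; rewrite T2x0.2 -T2x0.1.
  apply: le_trans (x0Z (S x0) (SZ x0) c) _.
  by have := bl_norm_le (T2 + c *: S) x0; rewrite x01 mulr1.
have aatt : norm_attaining T a by split.
have dT : dist_to T (ops_into X Z) = `|T| by apply: dist_to_bj_orth.
have dT2 : dist_to T2 (ops_into X2 Z2) = `|T|.
  by rewrite dist_to_bj_orth// T2x0.2.
have dx0 : dist_to (T2 x0) Z2 = `|T| by rewrite dist_to_bj_orth// T2x0.1.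
split=> //; first by rewrite dT (sup_dist_to _ aatt)// dist_to_bj_orth// Ta.
exists x0; first by split=> //; exact: L_projection_extreme aproj.
split=> //; rewrite (sup_dist_to _ x0att)//.
by split=> //; rewrite ?dx0 ?dT2 ?dT.
Qed.

(** * Banach lattices with additive norm *)

(** The common property of the three kinds of spaces on which the proof rests. *)
Definition L1_conic {R : realType} (X : normedModType R) :=
  exists (P : X -> Prop) (pos : X -> X), L1_cone P pos.

Lemma abstract_L1_conic {R : realType} (X : completeNormedModType R) :
  abstract_L1_space X -> L1_conic X.
Proof.
move=> [le [join [L add]]]; exists (fun x => le 0 x), (fun x => join x 0).
have leB x y : le x y -> le 0 (y - x).
  by move=> /(lattice_add L (- x)); rewrite subrr.
have leK x y : le 0 (y - x) -> le x y.
  by move=> /(lattice_add L x); rewrite add0r subrK.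
have addP x y : le 0 x -> le 0 y -> le 0 (x + y).
  move=> x0 y0; apply: (lattice_trans L y0).
  by have := lattice_add L y x0; rewrite add0r.
have scaleP (a : R) x : 0 <= a -> le 0 x -> le 0 (a *: x).
  by move=> a0 /(lattice_scale L a0); rewrite scaler0.
have posP x : le 0 (join x 0) by exact: lattice_joinr L _ _.
have posB x : le 0 (join x 0 - x) by apply: leB; exact: lattice_joinl L _ _.
have least x z : le 0 z -> le 0 (z - x) -> le 0 (z - join x 0).
  by move=> z0 zx; apply: leB; apply: (lattice_join_least L) => //; exact: leK.
split=> // x; rewrite -add//; set m := join x 0 + (join x 0 - x).
have m0 : le 0 m by exact: addP.
have joinm : join m (- m) = m.
  apply: (lattice_antisym L); last exact: lattice_joinl L _ _.
  apply: (lattice_join_least L); first exact: lattice_refl L _.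
  by apply: leK; rewrite opprK; exact: addP.
have joinx : join x (- x) = m.
  apply: (lattice_antisym L).
    apply: (lattice_join_least L); apply: leK.
      by have := addP _ _ (posB x) (posB x); congr le; rewrite /m; vec.
    by have := addP _ _ (posP x) (posP x); congr le; rewrite /m; vec.
  have h2 : (0 : R) <= 2^-1 by rewrite invr_ge0.
  set j := join x (- x); have jx : le 0 (j - x).
    by apply: leB; exact: lattice_joinl L _ _.
  have jNx : le 0 (j + x).
    by rewrite -[x in j + x]opprK; apply: leB; exact: lattice_joinr L _ _.
  have : le 0 (2^-1 *: (j + x) - join x 0).
    apply: least; first exact: scaleP.
    by have := scaleP _ _ h2 jx; congr le; vec.
  move=> Pj; apply: leK; have := addP _ _ Pj Pj.
  by congr le; rewrite /m; vec.
apply/eqP; rewrite eq_le; apply/andP; split; apply: (lattice_norm L).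
  by rewrite joinm joinx; exact: lattice_refl L _.
by rewrite joinm joinx; exact: lattice_refl L _.
Qed.

(** * Spaces of integrable functions *)

Section LebesgueSpace.
Context {d : measure_display} {T : measurableType d} {R : realType}
  (mu : {measure set T -> \bar R}).
Local Notation L1 := (LfunType mu (@lexx _ _ 1%E)).

Definition Lfun_abs (f : L1) : L1 :=
  Lfun_Sub (@lexx _ _ 1%E) (Lfun_norm (LfunP f)).

Context {V : normedModType R} (phi : {linear L1 -> V})
  (phi_norm : forall f, (`|phi f|)%:E = 'N[mu]_1[EFin \o f]%E).

Lemma L1_image_normE (f : L1) : (`|phi f|)%:E = (\int[mu]_x (`|f x|)%:E)%E.
Proof. by rewrite phi_norm Lnorm1; apply: eq_integral => x _. Qed.

Lemma L1_image_norm_le (f g : L1) : (forall t, `|f t| <= `|g t|) ->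
  `|phi f| <= `|phi g|.
Proof.
move=> fg; rewrite -lee_fin !L1_image_normE; apply: ge0_le_integral => //.
- by apply/measurable_EFinP; exact: measurable_funPT (Lfun_abs f).
- by apply/measurable_EFinP; exact: measurable_funPT (Lfun_abs g).
- by move=> t _; rewrite lee_fin.
Qed.

Lemma L1_image_normD (f g h : L1) : (forall t, `|h t| = `|f t| + `|g t|) ->
  `|phi h| = `|phi f| + `|phi g|.
Proof.
move=> hfg; apply: EFin_inj; rewrite EFinD !L1_image_normE -ge0_integralD//.
- by apply: eq_integral => t _; rewrite hfg.
- by apply/measurable_EFinP; exact: measurable_funPT (Lfun_abs f).
- by apply/measurable_EFinP; exact: measurable_funPT (Lfun_abs g).
Qed.

Context {X : normedModType R} (psi : {linear X -> V})
  (psi_norm : forall x, `|psi x| = `|x|)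
  (phi_onto : forall v, exists f, phi f = v)
  (psi_onto : forall v, exists x, psi x = v).

(** A vector is positive if some function that represents it is non-negative
    everywhere, so that no argument almost everywhere is needed: two functions
    represent the same vector as soon as the difference has norm zero. *)
Lemma L1_conic_of_isometry : L1_conic X.
Proof.
have [rep repE] := choice (fun x => phi_onto (psi x)).
have [inv invE] := choice (fun f => psi_onto (phi f)).
pose pp (f : L1) : L1 := 2^-1 *: (f + Lfun_abs f).
have ppE f t : pp f t = 2^-1 * (f t + `|f t|) by [].
pose P x := exists2 f : L1, (forall t, 0 <= f t) & phi f = psi x.
exists P, (fun x => inv (pp (rep x))); split.
- move=> x y [f f0 fx] [g g0 gy]; exists (f + g).
    by move=> t; exact: (addr_ge0 (f0 t) (g0 t)).
  by rewrite !linearD fx gy.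
- move=> a x a0 [f f0 fx]; exists (a *: f); last by rewrite !linearZ fx.
  by move=> t; exact: (mulr_ge0 a0 (f0 t)).
- move=> x y [f f0 fx] [g g0 gy]; rewrite -!psi_norm linearD -fx -gy -linearD.
  apply: L1_image_normD => t; have -> : (f + g) t = f t + g t by [].
  by rewrite !ger0_norm ?addr_ge0.
- move=> x; exists (pp (rep x)); last by rewrite invE.
  move=> t; rewrite ppE mulr_ge0 ?invr_ge0//.
  by have := lerNnormlW (lexx `|rep x t|); lra.
- move=> x; exists (pp (rep x) - rep x); last by rewrite !linearB invE repE.
  move=> t; have -> : (pp (rep x) - rep x) t = pp (rep x) t - rep x t by [].
  by rewrite ppE; have := ler_norm (rep x t); lra.
- move=> x z [k1 k1_ge0 k1z] [k2 k2_ge0 k2z].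
  pose m : L1 := 2^-1 *: (k1 + k2 - Lfun_abs (k1 - k2)).
  have mE t : m t = 2^-1 * (k1 t + k2 t - `|k1 t - k2 t|) by [].
  exists m.
    move=> t; rewrite mE mulr_ge0 ?invr_ge0//.
    rewrite subr_ge0; apply: le_trans (ler_normB _ _) _.
    by rewrite !ger0_norm.
  apply/esym/eqP; rewrite -subr_eq0 -normr_le0.
  rewrite linearB invE -k1z -!linearB.
  apply: (@le_trans _ _ `|phi (k1 - rep x - k2)|); last first.
    by rewrite !linearB k1z k2z repE linearB subrr normr0.
  apply: L1_image_norm_le => t.
  have -> : (k1 - pp (rep x) - m) t = k1 t - pp (rep x) t - m t by [].
  have -> : (k1 - rep x - k2) t = k1 t - rep x t - k2 t by [].
  rewrite ppE mE; set a := k1 t; set b := k2 t; set c := rep x t.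
  have -> : a - 2^-1 * (c + `|c|) - 2^-1 * (a + b - `|a - b|) =
      2^-1 * (a - c - b) + 2^-1 * (`|a - b| - `|c|) by field.
  apply: le_trans (ler_normD _ _) _; rewrite !normrM.
  have -> : `|2^-1 : R| = 2^-1 by rewrite ger0_norm ?invr_ge0.
  have : `| `|a - b| - `|c| | <= `|a - c - b|.
    by rewrite [a - c - b]addrAC; exact: ler_dist_dist.
  lra.
- move=> x; rewrite -!psi_norm linearB invE -repE -linearB.
  apply: L1_image_normD => t.
  have -> : (pp (rep x) - rep x) t = pp (rep x) t - rep x t by [].
  rewrite ppE; set c := rep x t.
  have -> : 2^-1 * (c + `|c|) - c = 2^-1 * (`|c| - c) by field.
  rewrite !normrM; have -> : `|2^-1 : R| = 2^-1 by rewrite ger0_norm ?invr_ge0.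
  rewrite [`|c + _|]ger0_norm ?[`| `|c| - c|]ger0_norm ?subr_ge0 ?ler_norm//.
    by field.
  by rewrite addrC -lerBlDr sub0r -normrN ler_norm.
Qed.

End LebesgueSpace.

Lemma dual_L1_predual_conic {R : realType} (X W : completeNormedModType R) :
  L1_predual W -> isometrically_isomorphic X (dual W) -> L1_conic X.
Proof.
move=> [d [T [mu [phi [phi_norm phi_onto]]]]] [psi [psi_norm psi_onto]].
exact: (L1_conic_of_isometry phi_norm psi_norm).
Qed.

(** * Spaces of normal measures *)

Section NormalRestriction.
Context {R : realType} {K : ptopologicalType}.
Context (Kcompact : compact [set: K]) (Khausdorff : hausdorff_space K).
Implicit Types mu : {finite_measure set (borel K) -> \bar R}.

Lemma borel_open (U : set K) : open U -> measurable (U : set (borel K)).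
Proof. by move=> oU; exact: sub_sigma_algebra. Qed.

Lemma borel_compact (C : set K) : compact C -> measurable (C : set (borel K)).
Proof.
move=> /(compact_closed Khausdorff)/closed_openC oC.
by rewrite -[C]setCK; apply: measurableC; exact: borel_open.
Qed.

Lemma borel_continuous (f : K -> R) : continuous f ->
  measurable_fun [set: borel K] (f : borel K -> R).
Proof.
move=> /continuousP cf; apply: (measurability _ (RGenOpens.measurableE R)).
move=> _ [_ [a [b ->] <-]]; rewrite setTI; apply: borel_open.
exact/cf/interval_open.
Qed.

(** The real-valued integral is $0$ where the extended one is infinite, so
    monotonicity in the measure requires finiteness. *)
Lemma continuous_integral_lty mu (f : K -> R) : continuous f ->
  (forall x, 0 <= f x) -> (\int[mu]_(x in [set: borel K]) (f x)%:E < +oo)%E.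
Proof.
move=> cf f0; have [||c _ cmax] := @compact_EVT_max _ R f [set: K] _ Kcompact.
- by exists point.
- exact: continuous_subspaceT.
apply: (@le_lt_trans _ _ (\int[mu]_(x in [set: borel K]) (cst (f c)%:E) x)%E).
  apply: ge0_le_integral => //.
  - by move=> x _; rewrite lee_fin.
  - by apply/measurable_EFinP; exact: borel_continuous.
  - by move=> x _; rewrite lee_fin; apply: cmax; rewrite inE.
rewrite integral_cst//; apply: lte_mul_pinfty.
- by rewrite lee_fin.
- by [].
- by rewrite ltey_eq fin_num_measure.
Qed.

Lemma fine_measureE mu A : measurable A -> mu A = (fine (mu A))%:E.
Proof. by move=> mA; rewrite fineK// fin_num_measure. Qed.

(** Cutting off a part of $B$ of measure less than $\varepsilon$ costs at most
    $\varepsilon$ in $B \cap D$. *)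
Lemma restriction_gap mu A B D e : measurable A -> measurable B ->
  measurable D -> A `<=` B -> (mu B < mu A + e%:E)%E ->
  (mu (B `&` D) <= mu (A `&` D) + e%:E)%E.
Proof.
move=> mA mB mD AB BA.
have {}BA : fine (mu B) < fine (mu A) + e.
  by rewrite -lte_fin EFinD -!fine_measureE.
have mAD : measurable (A `&` D) by exact: measurableI.
have mBA : measurable (B `\` A) by exact: measurableD.
have gap : fine (mu (B `\` A)) = fine (mu B) - fine (mu A).
  apply: EFin_inj; rewrite EFinB -!fine_measureE// measureD//; last first.
    by rewrite ltey_eq fin_num_measure.
  by congr (_ - mu _)%E; exact: setIidr.
have : fine (mu (B `&` D)) <= fine (mu (A `&` D)) + fine (mu (B `\` A)).
  rewrite -lee_fin EFinD -!fine_measureE//; last exact: measurableI.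
  apply: le_trans (measureU2 _ mAD mBA); apply: le_measure.
  - by rewrite inE; exact: measurableI.
  - by rewrite inE; exact: measurableU.
  - move=> x [Bx Dx]; have [Ax|nAx] := pselect (A x); first by left.
    by right.
have mBD : measurable (B `&` D) by exact: measurableI.
by rewrite (fine_measureE mu mBD) (fine_measureE mu mAD) -EFinD lee_fin gap; lra.
Qed.

Lemma normal_measure_restriction mu D : normal_measure mu -> measurable D ->
  exists2 nu : {finite_measure set (borel K) -> \bar R}, normal_measure nu &
    forall A, nu A = mu (A `&` D).
Proof.
move=> [mureg munorm] mD.
have moo : (mu D < +oo)%E by rewrite ltey_eq fin_num_measure.
have [nu nuE] : exists nu : {finite_measure set (borel K) -> \bar R},
    forall A, nu A = mu (A `&` D) by exists (mfrestr mD moo).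
exists nu => //; split.
  move=> A mA; have [muI muS] := mureg A mA; split.
  - apply/eqP; rewrite eq_le; apply/andP; split.
      apply: le_ereal_inf_tmp => _ [U [oU AU] <-].
      by apply: le_measure => //; rewrite inE//; exact: borel_open.
    apply/lee_addgt0Pr => e e0.
    have [U [oU AU] UA] : exists2 U : set K, open U /\ A `<=` U &
        (mu U < mu A + e%:E)%E.
      apply: contrapT => nU; have : (mu A + e%:E <= mu A)%E.
        rewrite [leRHS]muI; apply: le_ereal_inf_tmp => _ [U [oU AU] <-].
        by rewrite leNgt; apply/negP => UA; apply: nU; exists U.
      by rewrite fine_measureE// -EFinD lee_fin gerDl leNgt e0.
    have mU := borel_open oU.
    apply: ge_ereal_inf; exists (nu U); first by exists U.
    by rewrite !nuE; exact: restriction_gap.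
  - apply/eqP; rewrite eq_le; apply/andP; split; last first.
      apply: ge_ereal_sup => _ [C [cC CA] <-].
      by apply: le_measure => //; rewrite inE//; exact: borel_compact.
    apply/lee_addgt0Pr => e e0.
    have [C [cC CA] AC] : exists2 C : set K, compact C /\ C `<=` A &
        (mu A < mu C + e%:E)%E.
      apply: contrapT => nC; have : (mu A <= mu A - e%:E)%E.
        rewrite [leLHS]muS; apply: ge_ereal_sup => _ [C [cC CA] <-].
        have mC := borel_compact cC.
        rewrite leeBrDr// leNgt; apply/negP => AC; apply: nC; exists C => //.
      by rewrite fine_measureE// -EFinB lee_fin lerBrDr gerDl leNgt e0.
    have mC := borel_compact cC.
    apply: (@le_trans _ _ (nu C + e%:E)%E).
      by rewrite !nuE; exact: restriction_gap.
    by rewrite leeD2r//; apply: ereal_sup_ubound; exists C.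
move=> I le f dir dec e e0; have [i0 i0P] := munorm I le f dir dec e e0.
exists i0 => i /i0P; apply: le_lt_trans.
have [fcont _ fpos _] := dec.
have mf : measurable_fun [set: borel K] (EFin \o (f i : borel K -> R)).
  by apply/measurable_EFinP; exact: borel_continuous.
have int_ge0 (m : {finite_measure set (borel K) -> \bar R}) :
    (0 <= \int[m]_(x in [set: borel K]) (f i x)%:E)%E.
  by apply: integral_ge0 => x _; rewrite lee_fin.
have fin m : (\int[m : {finite_measure set (borel K) -> \bar R}]_(x in [set: borel K])
    (f i x)%:E)%E \is a fin_num.
  by rewrite ge0_fin_numE//; exact: continuous_integral_lty.
rewrite /Rintegral ger0_norm; last by apply: fine_ge0; exact: int_ge0.
rewrite ger0_norm; last by apply: fine_ge0; exact: int_ge0.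
apply: fine_le; [exact: fin | exact: fin |].
apply: ge0_le_measure_integral => //.
- move=> S mS; suff le_nu : (nu S <= mu S)%E by exact: le_nu.
  by rewrite nuE; apply: le_measure; rewrite ?inE//; exact: measurableI.
- by move=> x; rewrite lee_fin.
Qed.

Lemma normal_charge_restriction (nu : {charge set (borel K) -> \bar R}) D :
  normal_charge nu -> measurable D ->
  exists2 nu' : {charge set (borel K) -> \bar R}, normal_charge nu' &
    forall A, measurable A -> nu' A = nu (A `&` D).
Proof.
move=> [mu1 [mu2 [n1 n2 nuE]]] mD.
have [mu1' n1' mu1E] := normal_measure_restriction n1 mD.
have [mu2' n2' mu2E] := normal_measure_restriction n2 mD.
pose nu' : {charge set (borel K) -> \bar R} := crestr0 nu mD.
have nu'E A : measurable A -> nu' A = nu (A `&` D).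
  by move=> mA; rewrite /nu'/= /crestr0 mem_set.
exists nu' => //; exists mu1', mu2'; split=> // A mA.
by rewrite nu'E// nuE ?mu1E ?mu2E//; exact: measurableI.
Qed.

End NormalRestriction.

Lemma charge_total_variationE {R : realType} {K : ptopologicalType}
    (nu : {charge set (borel K) -> \bar R}) :
  exists P N, hahn_decomposition nu P N /\
    charge_total_variation nu = (nu P - nu N)%E.
Proof.
rewrite /charge_total_variation; set P := cid _; set N := cid _.
have PN := projT2 N; have [[mP _] [mN _] _ _] := PN.
exists (projT1 P), (projT1 N); split=> //.
rewrite /charge_variation jordan_posE cjordan_posE jordan_negE cjordan_negE.
by rewrite /crestr0 !mem_set// /crestr !setTI.
Qed.

(** The positive part of a charge is the restriction to the positive set of a
    Hahn decomposition; it is again normal, so it comes from a vector. *)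
Lemma normal_charges_conic {R : realType} (X : normedModType R)
    (K : ptopologicalType) : hyperstonean R K ->
  isometric_to_normal_charges X K -> L1_conic X.
Proof.
move=> [Kc Kh _ _] [J [Jnormal Jlin Jonto Jnorm]].
pose j x A := fine (J x A).
have JE x A : measurable A -> J x A = (j x A)%:E.
  by move=> mA; rewrite /j fineK// fin_num_measure.
have jlin a x y A : measurable A -> j (a *: x + y) A = a * j x A + j y A.
  by move=> mA; apply: EFin_inj; rewrite EFinD EFinM -!JE// Jlin.
have j0 A : measurable A -> j 0 A = 0.
  by move=> mA; have := jlin 1 0 0 A mA; rewrite scaler0 addr0; lra.
have jD x y A : measurable A -> j (x + y) A = j x A + j y A.
  by move=> mA; rewrite -[x]scale1r jlin// mul1r scale1r.
have jZ a x A : measurable A -> j (a *: x) A = a * j x A.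
  by move=> mA; rewrite -[a *: x]addr0 jlin// j0// addr0.
have jB x y A : measurable A -> j (x - y) A = j x A - j y A.
  by move=> mA; rewrite jD// -scaleN1r jZ// mulN1r.
have /choice[PN PNP] : forall x, exists PN : set (borel K) * set (borel K),
    hahn_decomposition (J x) PN.1 PN.2 /\ `|x| = j x PN.1 - j x PN.2.
  move=> x; have [P [N [PN tv]]] := charge_total_variationE (J x).
  have [[mP _] [mN _] _ _] := PN.
  exists (P, N); split=> //=; apply: EFin_inj.
  by rewrite Jnorm tv EFinB -!JE.
have mD x : measurable (PN x).1 by have [[[]]] := PNP x.
have mN x : measurable (PN x).2 by have [[_ []]] := PNP x.
have part x y A : measurable A ->
    j y A = j y (A `&` (PN x).1) + j y (A `&` (PN x).2).
  move=> mA; have [[_ _ PNT PN0] _] := PNP x; apply: EFin_inj.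
  rewrite EFinD -!JE//; try exact: measurableI.
  exact: charge_partition.
have posD x A : measurable A -> 0 <= j x (A `&` (PN x).1).
  move=> mA; have [[[_ +] _ _ _] _] := PNP x.
  move=> /(_ (A `&` (PN x).1) (measurableI _ _ mA (mD x)) (@subIsetr _ _ _)).
  by rewrite JE ?lee_fin//; exact: measurableI.
have negN x A : measurable A -> j x (A `&` (PN x).2) <= 0.
  move=> mA; have [[_ [_ +] _ _] _] := PNP x.
  move=> /(_ (A `&` (PN x).2) (measurableI _ _ mA (mN x)) (@subIsetr _ _ _)).
  by rewrite JE ?lee_fin//; exact: measurableI.
pose P x := forall A, measurable A -> 0 <= j x A.
have normP x : P x -> `|x| = j x setT.
  move=> Px; have [_ ->] := PNP x; have := part x x setT measurableT.
  have := negN x setT measurableT; rewrite !setTI.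
  by have := Px _ (mN x); lra.
have /choice[pos posE] : forall x, exists y,
    forall A, measurable A -> j y A = j x (A `&` (PN x).1).
  move=> x; have [nu nnu nuE] :=
    normal_charge_restriction Kc Kh (Jnormal x) (mD x).
  have [y yE] := Jonto _ nnu; exists y => A mA.
  by rewrite /j yE// nuE.
have posB x A : measurable A -> j (pos x - x) A = - j x (A `&` (PN x).2).
  by move=> mA; rewrite jB// posE// (part x x A mA); ring.
have Ppos x : P (pos x) by move=> A mA; rewrite posE//; exact: posD.
have PposB x : P (pos x - x).
  by move=> A mA; rewrite posB// oppr_ge0; exact: negN.
exists P, pos; split=> //.
- by move=> x y Px Py A mA; rewrite jD// addr_ge0// ?Px ?Py.
- by move=> a x a0 Px A mA; rewrite jZ// mulr_ge0// Px.
- move=> x y Px Py; rewrite !normP ?jD// => A mA.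
  by rewrite jD// addr_ge0// ?Px ?Py.
- move=> x z Pz Pzx A mA; rewrite jB// posE// (part x z A mA).
  have := Pz _ (measurableI _ _ mA (mN x)).
  have mAD := measurableI _ _ mA (mD x).
  by have := Pzx _ mAD; rewrite jB//; lra.
- move=> x; rewrite (normP _ (Ppos x)) (normP _ (PposB x)) posB// posE//.
  by rewrite (PNP x).2 !setTI.
Qed.

Unset Implicit Arguments.

Theorem mainTheorem5 (R : realType) (X Y : completeNormedModType R)
    (hX : [\/ exists W : completeNormedModType R,
                L1_predual W /\ isometrically_isomorphic X (dual W),
              exists K : ptopologicalType,
                hyperstonean R K /\ isometric_to_normal_charges X K |
              abstract_L1_space X])
    (Z : set Y) (hZ : linear_subspace Z) (hZc : closed Z)
    (T : BL X Y) (hTc : compact_op T) (hTm : multi_smooth_finite_order T)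
    (hTZ : bj_orth_set T (ops_into X Z)) :
  let X2 := dual (dual X) in
  let T2 := biadjoint T in
  let Z2 := annihilator (annihilator Z) in
  [/\ dist_to T (ops_into X Z)
        = sup [set dist_to (T x) Z | x in unit_sphere X],
      exists2 x0 : X2,
        (norm_attaining T2 `&` extreme_points (unit_ball X2)) x0 &
        bj_orth_set (T2 x0) Z2,
      bj_orth_set T2 (ops_into X2 Z2) &
      exists2 x0 : X2,
        (norm_attaining T2 `&` extreme_points (unit_ball X2)) x0 &
        [/\ dist_to T2 (ops_into X2 Z2)
              = sup [set dist_to (T2 x) Z2 | x in unit_sphere X2],
            sup [set dist_to (T2 x) Z2 | x in unit_sphere X2]
              = dist_to (T2 x0) Z2 &
            dist_to (T2 x0) Z2 = dist_to T (ops_into X Z)]].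
Proof.
move=> X2 T2 Z2.
have [P [pos hP]] : L1_conic X.
  case: hX => [[W [W1 XW]]|[K [Khs XK]]|Xl].
  - exact: dual_L1_predual_conic W1 XW.
  - exact: normal_charges_conic Khs XK.
  - exact: abstract_L1_conic.
have [dT T2Z [x0 x0P [x0Z x0d]]] := L1_cone_conclusion hP hZ hTc hTm hTZ.
by split=> //; exists x0.
Qed.
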